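(* Let $0<\epsilon<1$, and let $n$ and $m=m(n)$ tend to infinity and satisfy $m^2\log m\ll n^{\epsilon/2}$. Let $(G,H)\in\mathcal{G}_{n,d}\times\mathcal{G}_{m,d}$, with $d\ge 3$ constant, and let $f_n:V(G)\to V(H)$ be any sequence of functions. Then there exists a constant $C$ such that $$\mathbb{P}\left(\gamma(G,d_H,f_n)\le C\right)\to 1\quad\text{as } n\to\infty.$$
   Context: $\mathcal{G}_{n,d}$ denotes the uniform probability space of simple $d$-regular graphs on the vertex set $[n]=\{1,\dots,n\}$ ($nd$ and $md$ are assumed even); $G$ and $H$ are chosen independently. $a\ll b$ means $a=o(b)$. The functions $f_n$ are deterministic: for each $n$ (and $m=m(n)$), $f_n$ is a fixed map from the label set $[n]=V(G)$ to the label set $[m]=V(H)$, chosen before the random graphs. For a connected graph $H$, $d_H$ is the usual graph distance on $V(H)$ (the event that $H$ is disconnected has probability tending to $0$ and may be counted as failure). For a $d$-regular graph $G$ on $n$ vertices and $f:V(G)\to V(H)$, $\gamma(G,d_H,f)$ is the number satisfying $$\frac{\gamma(G,d_H,f)}{dn}\sum_{u\sim_G v} d_H^2(f(u),f(v))=\frac{1}{n^2}\sum_{u,v\in V(G)}d_H^2(f(u),f(v)),$$ where the first sum is over edges $\{u,v\}$ of $G$ and the second over ordered pairs of vertices; the statement $\gamma(G,d_H,f)\le C$ means that $\frac{1}{n^2}\sum_{u,v\in V(G)}d_H^2(f(u),f(v))\le\frac{C}{dn}\sum_{u\sim_G v} d_H^2(f(u),f(v))$ (so it holds trivially for constant $f$).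 *)

(* Defs.v *)
From mathcomp Require Import all_boot all_order all_algebra.
From mathcomp Require Import all_classical all_reals all_analysis.

Set Implicit Arguments.
Unset Strict Implicit.
Unset Printing Implicit Defensive.

Import Order.TTheory GRing.Theory Num.Theory.
Import numFieldNormedType.Exports.

Local Open Scope ring_scope.

(* A graph on the vertex set 'I_n is given by its set of edges, the edges
   being unordered pairs of vertices. *)
Notation edge_set n := {set {set 'I_n}}.

Definition simple_graph n (G : edge_set n) : bool :=
  [forall e in G, #|e| == 2].

Definition adj n (G : edge_set n) : rel 'I_n :=
  fun u v => [set u; v] \in G.

Definition regular n (G : edge_set n) (d : nat) : bool :=
  [forall u : 'I_n, #|[set v | adj G u v]| == d].

Definition regular_graphs (n d : nat) : {set edge_set n} :=
  [set G : edge_set n | simple_graph G && regular G d].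

Definition connected_graph n (H : edge_set n) : bool :=
  [forall x, forall y, connect (adj H) x y].

Definition walk (T : finType) (e : rel T) (k : nat) (x y : T) : bool :=
  [exists p : k.-tuple T, path e x p && (last x p == y)].

(* The least length of a walk from x to y. Such a length is always < #|T|
   when it exists (see gdistP and gdist_min below), and the junk value #|T| is
   returned when y is not reachable from x. *)
Definition gdist (T : finType) (e : rel T) (x y : T) : nat :=
  find (fun k => walk e k x y) (iota 0 #|T|).

Lemma gdist_lt (T : finType) (e : rel T) (x y : T) :
  connect e x y -> (gdist e x y < #|T|)%N.
Proof.
case/connectP=> p0 pp0 ->; case/shortenP: pp0 => p pp up _.
rewrite /gdist -[X in (_ < X)%N](size_iota 0 #|T|) -has_find.
apply/hasP; exists (size p).
  rewrite mem_iota /= add0n.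
  by have := max_card (mem (x :: p)); rewrite (card_uniqP up).
by apply/existsP; exists (in_tuple p); rewrite pp /=.
Qed.

Lemma gdistP (T : finType) (e : rel T) (x y : T) :
  connect e x y ->
  exists p, [/\ path e x p, last x p = y & size p = gdist e x y].
Proof.
move=> /gdist_lt lt_d.
have : walk e (gdist e x y) x y.
  have := lt_d; rewrite -[X in (_ < X)%N](size_iota 0 #|T|) -has_find.
  by move=> /(nth_find 0%N); rewrite nth_iota.
by move=> /existsP[p /andP[pp /eqP lp]]; exists p; split=> //; rewrite size_tuple.
Qed.

Lemma gdist_min (T : finType) (e : rel T) (x : T) (p : seq T) :
  path e x p -> (gdist e x (last x p) <= size p)%N.
Proof.
move=> pp; rewrite leqNgt; apply/negP => lt_p.
have lt_T : (size p < #|T|)%N.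
  by rewrite (leq_trans lt_p) // /gdist -[leqRHS](size_iota 0) find_size.
have := before_find 0%N lt_p; rewrite nth_iota // add0n /= => /negbT/negP; apply.
by apply/existsP; exists (in_tuple p); rewrite pp /=.
Qed.

(* gamma(G, d_H, f) <= C; each edge {u, v} of G is counted once, as the pair
   with u < v. *)
Definition gamma_le (R : realType) n m (d : nat) (G : edge_set n)
    (H : edge_set m) (f : 'I_n -> 'I_m) (C : R) : bool :=
  (n ^ 2)%:R^-1 *
    (\sum_(u < n) \sum_(v < n) (gdist (adj H) (f u) (f v) ^ 2)%:R)
  <= C / (d * n)%:R *
    (\sum_(u < n) \sum_(v < n | (u < v)%N && adj G u v)
       (gdist (adj H) (f u) (f v) ^ 2)%:R).

(* The probability of A for the uniform distribution on the finite set S. *)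
Definition uniform_pr (R : realType) (T : finType) (S : {set T})
    (A : pred T) : R :=
  #|[set x in S | A x]|%:R / #|S|%:R.

(* n -> oo along the n for which n * d is even. *)
Definition even_oo (d : nat) : set_system nat :=
  within [set n | ~~ odd (n * d)]%classic \oo%classic.

Global Instance even_oo_filter d : ProperFilter (even_oo d).
Proof.
apply: Build_ProperFilter_ex => P [N _ PN].
exists N.*2; apply: PN => /=; first by rewrite -addnn leq_addr.
by rewrite oddM odd_double.
Qed.

(* Main.v *)
Require Import Defs.
From mathcomp Require Import all_boot all_order all_algebra.
From mathcomp Require Import all_classical all_reals all_analysis.
From mathcomp Require Import zify ring lra fingroup perm fintype finset.

Import Order.TTheory GRing.Theory Num.Theory.
Import numFieldNormedType.Exports.

Set Implicit Arguments.
Unset Strict Implicit.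
Unset Printing Implicit Defensive.

(** Let F(u, v) = d_H(f u, f v)^2, and let T be the sum of F over all ordered
    pairs. For every connected H, whatever f is, all but a fraction
    O(1/m + m^3/n) of the d-regular graphs G satisfy gamma(G, d_H, f) <= 16
    ([card_not_gamma_le]); and a random d-regular graph on m vertices is
    connected up to probability O(m^(-1/2)) ([card_disconnected_small]). The
    growth condition yields m^4 <= n for large n ([leq_pow4_of_growth]), so the
    total failure probability is O(m^(-1/2)), which tends to 0.

    The graph G. The set of d-regular graphs is invariant under relabelling, so
    a given edge is present with probability exactly p = d/(n-1), and two given
    distinct edges are present together with probability at most
    p^2 (1 + O(1/n)) ([card_two_edges_bound]). Hence the sum of F over the edges
    of G has mean proportional to T and a small variance, provided that T
    is much larger than max F, which is at most m^2. This is so when every fibre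
    of f misses at least n/m vertices, for then T >= n^2/m, and Chebyshev's
    inequality applies ([edge_sum_concentrated]). Otherwise a single fibre
    contains all but a set S of fewer than n/m vertices. A vertex u of S
    contributes w(u) = d_H(f u, i)^2 for each edge from u to that fibre, the one
    over i. Weighted by w, nearly all of the edges at S go there, since S is so
    small ([weighted_degree_small]), while T <= 4 n sum_u w(u) by the triangle
    inequality.

    The graph H. For a degree function D, let W(D) be the number of simple
    graphs with degrees D times the product of the factorials D(u)!. Deleting
    an edge at a fixed vertex shows that W(D) <= (N-1)!!, where N is the sum of
    D ([graphs_with_degrees_upper]). Replacing an edge uv by xu and yv shows
    that one more unit of degree at x and at y multiplies W by at least
    N - O(1) ([graphs_with_degrees_attach]). A graph without edges between A and
    its complement is a graph on A together with a graph on the complement B.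
    Bounding the first one outright and extending the second one to all
    vertices, one finds that among the regular graphs those split by A, with
    |A| = a, have a proportion at most the product over i < da/2 of
    (2i+1) / (db + 2i - O(1)), and this is O('C(n, a)^(-d/2)) for a <= n/2
    ([cut_ratio]). There are 'C(n, a) sets of size a and d >= 3, so the union
    bound leaves the sum of 'C(n, a)^(-1/2) over 1 <= a <= n/2, which is
    O(n^(-1/2)). The same extension step, started from a path, shows that
    regular graphs exist ([regular_graphs_gt0]). *)

Local Open Scope nat_scope.

(** * Simple graphs with a prescribed degree function *)

(** Counted over edges and not over neighbours, so that adding or deleting an
    edge changes it by an indicator. *)
Definition degree n (G : edge_set n) (u : 'I_n) : nat := \sum_(e in G) (u \in e).

Definition graphs_with_degrees n (D : 'I_n -> nat) : {set edge_set n} :=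
  [set G : edge_set n | simple_graph G && [forall u, degree G u == D u]].

Lemma graphs_with_degreesP n (D : 'I_n -> nat) (G : edge_set n) :
  reflect (simple_graph G /\ degree G =1 D) (G \in graphs_with_degrees D).
Proof.
rewrite inE; apply: (iffP andP) => -[sG dG]; split=> //.
  by move=> u; apply/eqP; move/forallP: dG.
by apply/forallP => u; rewrite dG.
Qed.

Lemma pair_set_inj (T : finType) (u : T) : injective (fun v => [set u; v]).
Proof.
move=> v w /= /setP E.
have := E v; rewrite !inE eqxx orbT => /esym /orP[] /eqP // vu.
by have := E w; rewrite !inE eqxx orbT vu orbb => /eqP.
Qed.

Lemma adjC n (G : edge_set n) u v : adj G u v = adj G v u.
Proof. by rewrite /adj setUC. Qed.

Lemma adj_neq n (G : edge_set n) u v : simple_graph G -> adj G u v -> u != v.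
Proof.
move=> /forallP/(_ [set u; v])/implyP sG /sG.
by rewrite cards2; case: (u != v).
Qed.

Lemma simple_graphP n (G : edge_set n) :
  reflect (forall e, e \in G -> #|e| = 2) (simple_graph G).
Proof.
apply: (iffP forallP) => [sG e eG|sG e]; first by apply/eqP; apply: (implyP (sG e)).
by apply/implyP => /sG ->.
Qed.

Lemma card_adj n (G : edge_set n) (u : 'I_n) :
  simple_graph G -> #|[set v | adj G u v]| = degree G u.
Proof.
move=> sG; rewrite /degree -big_mkcondr /= sum1dep_card.
rewrite -(card_imset _ (@pair_set_inj _ u)); apply: eq_card => e.
rewrite inE; apply/imsetP/andP => [[v]|[eG ue]].
  by rewrite inE => uv ->; split; [exact: uv | exact: set21].
move: (simple_graphP G sG e eG) => /eqP /cards2P [a [b [_ def_e]]].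
move: ue; rewrite def_e !inE => /orP[] /eqP u_.
  by exists b; rewrite ?inE /adj u_ // -def_e.
by exists a; rewrite ?inE /adj u_ setUC // -def_e.
Qed.

Lemma regular_graphsE n d :
  regular_graphs n d = graphs_with_degrees (fun _ : 'I_n => d).
Proof.
apply/setP => G; rewrite !inE; case sG: (simple_graph G) => //=.
by apply: eq_forallb => u; rewrite card_adj.
Qed.

Lemma handshake n (G : edge_set n) :
  simple_graph G -> \sum_u degree G u = #|G|.*2.
Proof.
move=> /simple_graphP sG; rewrite exchange_big /= -muln2 -sum_nat_const.
apply: eq_bigr => e /sG <-; rewrite -sum1_card [RHS]big_mkcond /=.
by apply: eq_bigr => u _; case: (u \in e).
Qed.

Lemma degreeU1 n (G : edge_set n) e u :
  e \notin G -> degree (e |: G) u = (u \in e) + degree G u.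
Proof. by move=> eG; rewrite /degree big_setU1. Qed.

Lemma degreeD1 n (G : edge_set n) e u :
  e \in G -> degree G u = (u \in e) + degree (G :\ e) u.
Proof. by move=> eG; rewrite /degree (big_setD1 e). Qed.

Lemma in_pair (T : finType) (u v w : T) :
  u != v -> (w \in [set u; v] : nat) = (w == u) + (w == v).
Proof.
rewrite !inE; case: (eqVneq w u) => [->|_ _ /=]; last by [].
by case: (u == v).
Qed.

Lemma simple_graphU1 n (G : edge_set n) u v :
  simple_graph G -> u != v -> simple_graph ([set u; v] |: G).
Proof.
move=> /simple_graphP sG uv; apply/simple_graphP => e.
by rewrite !inE => /orP[/eqP->|/sG //]; rewrite cards2 uv.
Qed.

Lemma simple_graphS n (G G' : edge_set n) :
  G' \subset G -> simple_graph G -> simple_graph G'.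
Proof.
move=> /subsetP sub /simple_graphP sG; apply/simple_graphP => e /sub; exact: sG.
Qed.

Lemma sum_eq1 (T : finType) (v : T) : \sum_w (w == v) = 1.
Proof. by rewrite (bigD1 v) //= eqxx big1 // => w /negPf ->. Qed.

(** Deleting the edge uv is injective on the graphs that contain it. *)
Lemma card_graphs_with_edge n (D : 'I_n -> nat) (u v : 'I_n) : u != v ->
  #|[set G in graphs_with_degrees D | adj G u v]|
  <= #|graphs_with_degrees (fun w => D w - (w == u) - (w == v))|.
Proof.
move=> uv; set S := [set G in _ | _].
have inj : {in S &, injective (fun G : edge_set n => G :\ [set u; v])}.
  move=> G1 G2; rewrite !inE => /andP[_ e1] /andP[_ e2] E.
  by rewrite -(setD1K e1) -(setD1K e2) E.
rewrite -(card_in_imset inj); apply: subset_leq_card.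
apply/subsetP => _ /imsetP[G + ->];
  rewrite inE => /andP[/graphs_with_degreesP[sG dG] e].
apply/graphs_with_degreesP; split; first exact: simple_graphS (subD1set _ _) sG.
move=> w; rewrite -dG (degreeD1 w e) in_pair // addnC -subnDA addnK //.
Qed.

Lemma sum_card_adj n (D : 'I_n -> nat) (v : 'I_n) :
  \sum_u #|[set G in graphs_with_degrees D | adj G v u]|
  = #|graphs_with_degrees D| * D v.
Proof.
under eq_bigr => u _ do rewrite -sum1dep_card big_mkcondr /=.
rewrite exchange_big /= -sum_nat_const; apply: eq_bigr => G.
move=> /graphs_with_degreesP[sG dG].
by rewrite -dG -card_adj // -sum1dep_card -big_mkcond.
Qed.

Lemma prod_factS n (D D' : 'I_n -> nat) u :
  (forall w, D' w = D w + (w == u)) ->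
  \prod_w (D' w)`! = (D u).+1 * \prod_w (D w)`!.
Proof.
move=> DE; rewrite (bigD1 u) //= [in RHS](bigD1 u) //= mulnA; congr (_ * _).
  by rewrite DE eqxx addn1 factS.
by apply: eq_bigr => w /negPf wu; rewrite DE wu addn0.
Qed.

(** The bound is the number (2k-1)!! of perfect matchings of 2k half-edges. At a
    vertex v of positive degree, deleting an edge vu leads to a total degree
    smaller by 2, and the two factorials that change absorb D u * D v. The
    values D u with u different from v sum to at most 2k-1, the new factor. *)
Lemma graphs_with_degrees_upper n k (D : 'I_n -> nat) : \sum_u D u = k.*2 ->
  #|graphs_with_degrees D| * \prod_u (D u)`! <= \prod_(i < k) i.*2.+1.
Proof.
elim: k D => [|k IHk] D sumD.
  have D0 u : D u = 0 by apply/eqP; move/eqP: sumD;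
    rewrite sum_nat_eq0 => /forallP/(_ u).
  rewrite big_ord0 big1 ?muln1 => [|u _]; last by rewrite D0.
  rewrite -(cards1 (set0 : edge_set n)); apply/subset_leq_card/subsetP => G.
  move=> /graphs_with_degreesP[sG dG]; rewrite inE; apply/eqP.
  apply: cards0_eq; have := handshake sG; under eq_bigr => u _ do rewrite dG D0.
  by rewrite big1 // => /esym/eqP; rewrite double_eq0 => /eqP.
have [v Dv] : exists v, 0 < D v.
  apply/existsP; rewrite -[X in is_true X]negbK negb_exists; apply/negP => /forallP D0.
  by move: sumD; rewrite big1 // => u _; apply/eqP; rewrite -leqn0 leqNgt.
set P := \prod_(i < k.+1) _; set c := #|_|; set W := \prod_u _.
rewrite -(leq_pmul2r Dv) mulnAC -sum_card_adj big_distrl /=.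
have le u : u != v -> #|[set G in graphs_with_degrees D | adj G v u]| * W
    <= D u * (\prod_(i < k) i.*2.+1 * D v).
  move=> uv; have [Du|Du] := posnP (D u).
    rewrite Du mul0n leqn0 muln_eq0; apply/orP; left; rewrite cards_eq0.
    apply/eqP/setP => G; rewrite !inE; apply/negP => /andP[/andP[sG /forallP dG]].
    rewrite adjC => vu; have := dG u;
      rewrite -card_adj // Du cards_eq0 => /eqP/setP/(_ v).
    by rewrite !inE vu.
  pose D1 w := D w - (w == u); pose D2 w := D w - (w == v) - (w == u).
  have -> : W = D u * (D v * \prod_w (D2 w)`!).
    rewrite /W (@prod_factS _ D1 _ u) => [|w]; last first.
      by rewrite /D1; case: eqVneq => [->|_]; lia.
    rewrite (@prod_factS _ D2 _ v) => [|w]; last first.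
      by rewrite /D1 /D2; case: (eqVneq w v) => [->|_];
        rewrite 1?eq_sym ?(negPf uv); lia.
    by rewrite /D1 /D2 !eqxx eq_sym (negPf uv); congr (_ * (_ * _)); lia.
  rewrite mulnCA leq_mul2l mulnCA [X in _ <= X]mulnC leq_mul2l; apply/orP; right;
    apply/orP; right.
  apply: leq_trans (IHk D2 _); last first.
    have : \sum_w D w = \sum_w (D2 w + ((w == v) + (w == u))).
      apply: eq_bigr => w _; rewrite /D2.
      have [wv|_] := eqVneq w v; have [wu|_] := eqVneq w u.
      - by rewrite -wv -wu eqxx in uv.
      - by rewrite wv; lia.
      - by rewrite wu; lia.
      - by lia.
    by rewrite sumD !big_split /= !sum_eq1; lia.
  rewrite leq_mul2r; apply/orP; right.
  by apply: card_graphs_with_edge; rewrite eq_sym.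
rewrite (bigD1 v) //= [X in X * W](_ : _ = 0) => [|]; last first.
  apply/eqP; rewrite cards_eq0; apply/eqP/setP => G; rewrite !inE.
  by apply/negP => /andP[/andP[sG _] /(adj_neq sG)]; rewrite eqxx.
apply: (@leq_trans (\sum_(u | u != v) D u * (\prod_(i < k) i.*2.+1 * D v))).
  exact: leq_sum.
rewrite -big_distrl /= /P big_ord_recr /= mulnA leq_mul2r; apply/orP; right.
rewrite mulnC leq_mul2l; apply/orP; right.
by move: sumD; rewrite (bigD1 v) //=; lia.
Qed.

(** * Creating two units of degree by rewiring one edge *)

(** The choices (u, v) that a rewiring at x and y must avoid have u equal or
    adjacent to x, or v equal or adjacent to y: at most (d+1) d of each kind. *)
Definition blocked_pairs d := 2 * (d.+1 * d).

Lemma card_sections (A B : finType) (S : {set A * B}) :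
  #|S| = \sum_a #|[set b | (a, b) \in S]|.
Proof.
rewrite -sum1_card [LHS]big_mkcond /=.
rewrite (eq_bigr (fun p => if (p.1, p.2) \in S then 1 else 0)) => [|[]] //.
rewrite -(pair_bigA _ (fun a b => if (a, b) \in S then 1 else 0)) /=.
apply: eq_bigr => a _.
by rewrite -big_mkcond -sum1_card; apply: eq_bigl => b; rewrite inE.
Qed.

Lemma card_sections_snd (A B : finType) (S : {set A * B}) :
  #|S| = (\sum_b #|[set a | (a, b) \in S]|)%N.
Proof.
rewrite card_sections; under eq_bigr => a _ do rewrite -sum1dep_card big_mkcond /=.
rewrite exchange_big; apply: eq_bigr => b _.
by rewrite -sum1dep_card [RHS]big_mkcond.
Qed.

Lemma card_adj_from n (G : edge_set n) d (P : pred 'I_n) :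
  simple_graph G -> (forall u, degree G u <= d) ->
  #|[set p : 'I_n * 'I_n | P p.1 && adj G p.1 p.2]| <= #|[set u | P u]| * d.
Proof.
move=> sG dG; rewrite card_sections -sum_nat_const [leqRHS]big_mkcond /=.
apply: leq_sum => u _; rewrite inE; case Pu: (P u).
  by apply: (leq_trans _ (dG u)); rewrite -card_adj //; apply: subset_leq_card;
    apply/subsetP => v; rewrite !inE /= Pu.
by rewrite leqn0 cards_eq0; apply/eqP/setP => v; rewrite !inE /= Pu.
Qed.

(** Ensures that [attach] yields a simple graph with two new edges. The cases
    v = x and u = y are excluded too: xu or yv would be the edge uv. *)
Definition attachable n (G : edge_set n) (x y u v : 'I_n) :=
  [&& adj G u v, u != x, ~~ adj G x u, v != y & ~~ adj G y v].

Lemma card_attachable n (G : edge_set n) d (x y : 'I_n) :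
  simple_graph G -> (forall u, degree G u <= d) ->
  \sum_u degree G u - blocked_pairs d
  <= #|[set p | attachable G x y p.1 p.2]|.
Proof.
move=> sG dG; rewrite leq_subLR.
have nbhd z : #|[set u | (u == z) || adj G z u]| <= d.+1.
  rewrite (_ : [set u | _] = z |: [set u | adj G z u]); last by apply/setP => u;
    rewrite !inE.
  rewrite cardsU1 -add1n leq_add ?leq_b1 //;
    exact: leq_trans (eq_leq (card_adj _ sG)) (dG z).
pose near z := [pred u | (u == z) || adj G z u].
set S := [set p | _].
have swap : #|[set p : 'I_n * 'I_n | near y p.2 && adj G p.1 p.2]| <= d.+1 * d.
  apply: (leq_trans _ (leq_mul (nbhd y) (leqnn d))).
  apply: (leq_trans _ (card_adj_from (near y) sG dG)).
  have swap_inj : injective (fun p : 'I_n * 'I_n =>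
    (p.2, p.1)) by move=> [a b] [a' b'] /= [-> ->].
  rewrite -(card_imset _ swap_inj);
    apply/subset_leq_card/subsetP => _ /imsetP[[a b] + ->].
  by rewrite !inE /= [adj G b a]adjC.
have : \sum_u degree G u <= #|[set p : 'I_n * 'I_n | near x p.1 && adj G p.1 p.2]|
   + #|[set p : 'I_n * 'I_n | near y p.2 && adj G p.1 p.2]| + #|S|.
  under eq_bigr => u _ do rewrite -card_adj //.
  pose all := [set p : 'I_n * 'I_n | adj G p.1 p.2].
  rewrite (_ : \sum_u _ = #|all|); last first.
    by rewrite card_sections; apply: eq_bigr => u _; apply: eq_card => v; rewrite !inE.
  apply: (leq_trans _ (leq_add (leq_card_setU _ _) (leqnn _))).
  apply: (leq_trans _ (leq_card_setU _ _)); apply/subset_leq_card/subsetP => -[u v].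
  rewrite !inE /attachable /= => uv; rewrite uv !andbT /=.
  by case: (u == x); case: (v == y); case: (adj G x u); case: (adj G y v).
move/leq_trans; apply; rewrite leq_add2r /blocked_pairs mul2n -addnn leq_add //.
exact: leq_trans (card_adj_from (near x) sG dG) (leq_mul (nbhd x) (leqnn d)).
Qed.

(** For x = y, the edge uv becomes the path u x v. *)
Definition attach n (G : edge_set n) (x y u v : 'I_n) : edge_set n :=
  [set x; u] |: ([set y; v] |: G :\ [set u; v]).

Lemma attachable_new_edges n (G : edge_set n) (x y u v : 'I_n) :
  simple_graph G -> attachable G x y u v ->
  [set y; v] \notin G :\ [set u; v] /\
  [set x; u] \notin [set y; v] |: G :\ [set u; v].
Proof.
move=> sG /and5P[uv ux xu vy yv]; split.
  by rewrite in_setD1 (negbTE (yv : [set y; v] \notin G)) andbF.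
rewrite in_setU1 in_setD1 (negbTE (xu : [set x; u] \notin G)) andbF orbF.
apply/eqP => /setP E; have := E x; have := E u.
rewrite !inE !eqxx orbT /= => /esym/orP[] /eqP E1; last first.
  by move: (adj_neq sG uv); rewrite E1 eqxx.
move=> /esym /orP[] /eqP E2; first by rewrite E1 E2 eqxx in ux.
by move: xu; rewrite E2 adjC uv.
Qed.

Lemma attach_graphs_with_degrees n (D D' : 'I_n -> nat) (G : edge_set n)
    (x y u v : 'I_n) :
  (forall w, D' w = D w + (w == x) + (w == y)) ->
  G \in graphs_with_degrees D -> attachable G x y u v ->
  attach G x y u v \in graphs_with_degrees D'.
Proof.
move=> DE /graphs_with_degreesP[sG dG] ok.
have [e1 e2] := attachable_new_edges sG ok.
case/and5P: ok => uv ux xu vy yv.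
apply/graphs_with_degreesP; split.
  apply: simple_graphU1; last by rewrite eq_sym.
  apply: simple_graphU1; last by rewrite eq_sym.
  exact: simple_graphS (subD1set _ _) sG.
move=> w; rewrite /attach !degreeU1 // DE -dG (degreeD1 w uv) !in_pair //; last 3 first.
- exact: adj_neq sG uv.
- by rewrite eq_sym.
- by rewrite eq_sym.
move: (nat_of_bool (w == x)) (nat_of_bool (w == u)) (nat_of_bool (w == y))
  (nat_of_bool (w == v)) (degree _ _) => *; lia.
Qed.

(** The rewiring can be undone once its four vertices are known. *)
Lemma attachK n (G : edge_set n) (x y u v : 'I_n) :
  simple_graph G -> attachable G x y u v ->
  G = [set u; v] |: attach G x y u v :\ [set x; u] :\ [set y; v].
Proof.
move=> sG ok; have [e1 e2] := attachable_new_edges sG ok.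
by rewrite /attach setU1K // setU1K // setD1K //; case/and5P: ok.
Qed.

(** Double counting of the rewirings from degrees D to degrees D'. Each graph
    with degrees D has at least sum D - O(1) of them. Each graph with degrees D'
    is reached at most once for every choice of a neighbour u of x and a
    neighbour v of y, distinct when x = y, and the number of these choices is
    exactly the quotient of the two products of factorials. *)
Lemma graphs_with_degrees_attach n d (D D' : 'I_n -> nat) (x y : 'I_n) :
  (forall w, D' w = D w + (w == x) + (w == y)) -> (forall w, D w <= d) ->
  #|graphs_with_degrees D| * \prod_w (D w)`! * (\sum_w D w - blocked_pairs d)
  <= #|graphs_with_degrees D'| * \prod_w (D' w)`!.
Proof.
move=> DE Dd.
pose D1 w := D w + (w == x).
rewrite (@prod_factS _ D1 D' y) // (@prod_factS _ D D1 x) //.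
rewrite [leqLHS]mulnAC !mulnA leq_mul2r; apply/orP; right.
pose S := [set t : edge_set n * ('I_n * 'I_n) |
  (t.1 \in graphs_with_degrees D) && attachable t.1 x y t.2.1 t.2.2].
pose S' := [set t : edge_set n * ('I_n * 'I_n) |
  [&& t.1 \in graphs_with_degrees D', adj t.1 x t.2.1, adj t.1 y t.2.2
    & (x == y) ==> (t.2.1 != t.2.2)]].
pose h (t : edge_set n * ('I_n * 'I_n)) := (attach t.1 x y t.2.1 t.2.2, t.2).
apply: (@leq_trans #|S|).
  rewrite card_sections -sum_nat_const [leqLHS]big_mkcond /=; apply: leq_sum => G _.
  case: ifP => // GD; have /graphs_with_degreesP[sG dG] := GD.
  have -> : \sum_w D w = \sum_w degree G w by apply: eq_bigr => w _; rewrite dG.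
  have Gd u : degree G u <= d by rewrite dG.
  apply: (leq_trans (card_attachable x y sG Gd)).
  by apply: subset_leq_card; apply/subsetP => p; rewrite inE => ok; rewrite 2!inE /= GD.
apply: (@leq_trans #|S'|).
  rewrite -(@card_in_imset _ _ h S) => [|[G1 p1] [G2 p2]]; last first.
    rewrite !inE /= => /andP[/andP[s1 _] ok1] /andP[/andP[s2 _] ok2] [E pp].
    by rewrite (attachK s1 ok1) (attachK s2 ok2) E pp.
  apply/subset_leq_card/subsetP => _ /imsetP[[G [u v]] + ->].
  rewrite inE /= => /andP[GD ok]; rewrite inE /=.
  rewrite (attach_graphs_with_degrees DE GD ok) /adj /attach !inE !eqxx orbT /=.
  have /and5P[uv _ _ _ _] := ok; apply/implyP => _.
  by move: GD; rewrite inE => /andP[sG _]; exact: adj_neq sG uv.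
rewrite card_sections -mulnA -sum_nat_const [leqRHS]big_mkcond /=;
  apply: leq_sum => G _.
case: ifP => GD; last by rewrite leqn0 cards_eq0; apply/eqP/setP => p;
  rewrite in_set0 2!inE /= GD.
have /graphs_with_degreesP[sG dG] := GD.
rewrite card_sections /=.
(* When x = y, the vertex x gains two units of degree, and the neighbour u is no
   longer available for v: both effects are the summand (x == y). *)
have Dx : #|[set u | adj G x u]| = (D x).+1 + (x == y).
  by rewrite card_adj // dG DE eqxx addn1.
apply: (@leq_trans (\sum_(u in [set u | adj G x u]) (D y).+1)); last first.
  rewrite sum_nat_const Dx /D1; case: (eqVneq x y) => [->|] /=; rewrite ?eqxx.
    by rewrite !addn1 mulnC.
  by rewrite !addn0 mulnC.
rewrite [leqRHS]big_mkcond /=; apply: leq_sum => u _.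
rewrite inE; case xu: (adj G x u); last first.
  by rewrite leqn0 cards_eq0; apply/eqP/setP => v; rewrite !inE /= xu andbF.
have Dy : #|[set v | adj G y v]| = (D y).+1 + (x == y).
  by rewrite card_adj // dG DE eqxx addn1 addSn eq_sym.
case: (eqVneq x y) Dy => [xy|_] Dy.
  have uy : u \in [set v | adj G y v] by rewrite inE -xy.
  move: Dy; rewrite (cardsD1 u) uy addn1 add1n => -[<-].
  apply/subset_leq_card/subsetP => v; rewrite !inE /= => /and4P[_ _ -> /=].
  by rewrite xy eqxx andbT eq_sym.
rewrite addn0 in Dy; rewrite -Dy.
by apply/subset_leq_card/subsetP => v; rewrite !inE /= => /and4P[].
Qed.

(** * Counting graphs without edges across a cut *)

(** The missing degrees are filled two units at a time, at any two places. *)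
Lemma graphs_with_degrees_lower n d k (D D' : 'I_n -> nat) :
  (forall w, D w <= D' w) -> (forall w, D' w <= d) ->
  \sum_w D' w = \sum_w D w + k.*2 ->
  #|graphs_with_degrees D| * \prod_w (D w)`!
    * \prod_(i < k) (\sum_w D w + i.*2 - blocked_pairs d)
  <= #|graphs_with_degrees D'| * \prod_w (D' w)`!.
Proof.
move=> + D'd; elim: k D => [|k IHk] D DD' sumD'.
  have -> : D = D'; last by rewrite big_ord0 muln1.
  apply/funext => w; apply/eqP; rewrite eqn_leq DD' /=.
  move: sumD'; rewrite double0 addn0 (bigD1 w) //= [RHS](bigD1 w) //= => E.
  rewrite -(leq_add2r (\sum_(i | i != w) D i)) -E leq_add2l.
  exact: leq_sum.
have deficit (E : 'I_n -> nat) : \sum_w E w < \sum_w D' w -> exists x, E x < D' x.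
  move=> lt; apply/existsP; apply: contraLR lt => /existsPn ge.
  by rewrite -leqNgt; apply: leq_sum => w _; rewrite leqNgt ge.
have [|x Dx] := deficit D; first by rewrite sumD' -addn1 leq_add2l.
pose D1 w := D w + (w == x).
have sumD1 : \sum_w D1 w = (\sum_w D w).+1 by rewrite big_split /= sum_eq1 addn1.
have [|y Dy] := deficit D1; first by rewrite sumD1 sumD' doubleS; lia.
pose D2 w := D1 w + (w == y).
have sumD2 : \sum_w D2 w = (\sum_w D w).+2 by rewrite big_split /= sumD1 sum_eq1 addn1.
have D1D' w : D1 w <= D' w.
  by rewrite /D1; case: eqVneq => [->|_]; rewrite ?addn0 ?addn1.
have D2D' w : D2 w <= D' w.
  by rewrite /D2; case: eqVneq => [->|_]; rewrite ?addn0 ?addn1.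
have := IHk D2 D2D'; rewrite sumD2 sumD' => /(_ _)/(leq_trans _); apply; last by lia.
rewrite big_ord_recl /= addn0 mulnA leq_mul //.
  by apply: (@graphs_with_degrees_attach _ d D D2 x y) => // w;
    apply: leq_trans (DD' w) (D'd w).
by apply: leq_prod => i _; rewrite /bump leq0n add1n doubleS !addSnnS.
Qed.

Definition splits n (G : edge_set n) (A : {set 'I_n}) :=
  [forall e in G, (e \subset A) || (e \subset ~: A)].

Lemma splitsC n (G : edge_set n) A : splits G A = splits G (~: A).
Proof. by apply: eq_forallb => e; rewrite setCK orbC. Qed.

Definition degree_on n d (A : {set 'I_n}) (w : 'I_n) := d * (w \in A).

Lemma splits_restrict n d (G : edge_set n) A :
  G \in regular_graphs n d -> splits G A ->
  [set e in G | e \subset A] \in graphs_with_degrees (degree_on d A).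
Proof.
rewrite regular_graphsE => /graphs_with_degreesP[sG dG] /forall_inP spl.
apply/graphs_with_degreesP; split.
  by apply: simple_graphS sG; apply/subsetP => e; rewrite inE => /andP[].
move=> w; rewrite /degree /degree_on -(dG w) /degree big_distrl /= [LHS]big_mkcond
  [RHS]big_mkcond /=.
apply: eq_bigr => e _; rewrite inE; case eG: (e \in G) => //=.
have := spl e eG; case wA: (w \in A); rewrite ?muln1 ?muln0.
  case: ifP => //= _ eA; case we: (w \in e) => //.
  by move/subsetP: eA => /(_ w we); rewrite inE wA.
case: ifP => // /subsetP eA _; case we: (w \in e) => //.
by rewrite (eA w we) in wA.
Qed.

Lemma card_splits n d (A : {set 'I_n}) :
  #|[set G in regular_graphs n d | splits G A]|
  <= #|graphs_with_degrees (degree_on d A)|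
     * #|graphs_with_degrees (degree_on d (~: A))|.
Proof.
pose h (G : edge_set n) := ([set e in G | e \subset A], [set e in G | e \subset ~: A]).
rewrite -cardsX -(@card_in_imset _ _ h).
  apply/subset_leq_card/subsetP => _ /imsetP[G + ->]; rewrite inE => /andP[rG sG].
  by rewrite inE /= !splits_restrict // -splitsC.
have hE (G : edge_set n) : splits G A -> G = (h G).1 :|: (h G).2.
  by move=> /forall_inP sG; apply/setP => e; rewrite !inE;
    case eG: (e \in G) => //=; rewrite sG.
by move=> G1 G2; rewrite !inE => /andP[_ s1] /andP[_ s2] E;
  rewrite (hE _ s1) (hE _ s2) E.
Qed.

(** Either a component or the union of the other ones has at most half of the
    vertices. *)
Lemma disconnected_splits n (G : edge_set n) :
  simple_graph G -> ~~ connected_graph G ->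
  exists A : {set 'I_n}, (0 < #|A|) && (#|A|.*2 <= n) && splits G A.
Proof.
move=> /simple_graphP sG /forallPn[x /forallPn[y xy]].
pose A := [set z | connect (adj G) x z].
have sA : splits G A.
  apply/forall_inP => e eG.
  have /eqP/cards2P[a [b [_ def_e]]] := sG e eG.
  have ab : adj G a b by rewrite /adj -def_e.
  have step u v : adj G u v -> u \in A -> v \in A.
    by rewrite !inE => uv xu; apply: connect_trans xu (connect1 uv).
  have AE : (a \in A) = (b \in A) by apply/idP/idP; apply: step; rewrite // adjC.
  by rewrite def_e !subUset !sub1set !in_setC AE !andbb; case: (b \in A).
have xA : x \in A by rewrite inE connect0.
have yA : y \in ~: A by rewrite !inE.
have := cardsC A; rewrite card_ord => cA.
have [le|gt] := leqP #|A|.*2 n.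
  by exists A; rewrite le sA !andbT card_gt0; apply/set0Pn; exists x.
exists (~: A); rewrite -splitsC sA andbT; apply/andP; split; last first.
  by move: #|A| #|~: A| cA gt => a b <-; rewrite -!addnn ltn_add2l leq_add2r => /ltnW.
by rewrite card_gt0; apply/set0Pn; exists y.
Qed.

Lemma card_disconnected_le n d :
  #|[set G in regular_graphs n d | ~~ connected_graph G]|
  <= \sum_(A : {set 'I_n} | (0 < #|A|) && (#|A|.*2 <= n))
       #|graphs_with_degrees (degree_on d A)|
       * #|graphs_with_degrees (degree_on d (~: A))|.
Proof.
pose B A := [set G in regular_graphs n d | splits G A].
apply: (@leq_trans (\sum_(A : {set 'I_n} | (0 < #|A|) && (#|A|.*2 <= n)) #|B A|));
  last first.
  by apply: leq_sum => A _; exact: card_splits.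
apply: (@leq_trans #|\bigcup_(A : {set 'I_n} | (0 < #|A|) && (#|A|.*2 <= n)) B A|).
  apply/subset_leq_card/subsetP => G; rewrite inE => /andP[rG dG].
  have := rG; rewrite inE => /andP[sG _].
  have [A /andP[A1 A2]] := disconnected_splits sG dG.
  by apply/bigcupP; exists A; rewrite // inE rG.
elim/big_rec2: _ => [|A s S _ le]; first by rewrite cards0.
by apply: leq_trans (leq_card_setU _ _) _; rewrite leq_add2l.
Qed.

Lemma sum_degree_on n d (A : {set 'I_n}) : \sum_w degree_on d A w = d * #|A|.
Proof.
rewrite -big_distrr /= -sum1_card [in RHS]big_mkcond /=.
congr (_ * _).
Qed.

Lemma prod_fact_degree_on n d (A : {set 'I_n}) :
  \prod_w (degree_on d A w)`! = d`! ^ #|A|.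
Proof.
rewrite -prod_nat_const [RHS]big_mkcond /=; apply: eq_bigr => w _.
by rewrite /degree_on; case: (w \in A); rewrite ?muln1 // muln0.
Qed.

(** Any d-regular graph on A is counted by the upper bound, and those on the
    complement are extended to all vertices by the lower bound; the factorials
    on both sides are the same power of d! and cancel. *)
Lemma card_graphs_cut n d (A : {set 'I_n}) k : k.*2 = d * #|A| ->
  #|graphs_with_degrees (degree_on d A)|
    * #|graphs_with_degrees (degree_on d (~: A))|
    * \prod_(i < k) (d * #|~: A| + i.*2 - blocked_pairs d)
  <= #|regular_graphs n d| * \prod_(i < k) i.*2.+1.
Proof.
move=> dA; have cA : #|A| + #|~: A| = n by rewrite cardsC card_ord.
have := @graphs_with_degrees_upper n k (degree_on d A).
rewrite sum_degree_on prod_fact_degree_on => /(_ (esym dA)) upper.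
have := @graphs_with_degrees_lower n d k (degree_on d (~: A)) (fun _ =>
  d) _ (fun _ => leqnn d).
rewrite sum_degree_on !prod_fact_degree_on prod_nat_const sum_nat_const card_ord.
rewrite -regular_graphsE => /(_ _ _)/wrap[].
- by move=> w; rewrite /degree_on -[leqRHS]muln1 leq_mul2l leq_b1 orbT.
- by rewrite dA mulnC -mulnDr addnC cA.
move=> lower.
have fact_pow : d`! ^ #|A| * d`! ^ #|~: A| = d`! ^ n by rewrite -expnD cA.
have fact_gt0 : 0 < d`! ^ n by rewrite expn_gt0 fact_gt0.
rewrite -(leq_pmul2r fact_gt0) -[in leqLHS]fact_pow.
have := leq_mul upper lower.
move: #|graphs_with_degrees _| #|graphs_with_degrees _| (\prod_(i < k) _)
  (\prod_(i < k) _) (d`! ^ n) (d`! ^ _) (d`! ^ _)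
  #|regular_graphs n d| => *.
lia.
Qed.

Lemma ffactD n i j : n ^_ (i + j) = n ^_ i * (n - i) ^_ j.
Proof.
by elim: j => [|j IHj]; rewrite ?addn0 ?muln1 // addnS !ffactnSr IHj mulnA subnDA.
Qed.

Lemma leq_ffact_exp4 r x y : x <= 4 * (y - r) -> x ^_ r <= 4 ^ r * y ^_ r.
Proof.
move=> le; rewrite !ffact_prod -[X in 4 ^ X]card_ord -prod_nat_const -big_split /=.
by apply: leq_prod => i _; have := ltn_ord i; lia.
Qed.

Lemma leq_bin_mul m n i j : 'C(m, i) * 'C(n, j) <= 'C(m + n, i + j).
Proof.
rewrite -binomial.Vandermonde.
have lt : i < (i + j).+1 by rewrite ltnS leq_addr.
by rewrite (bigD1 (Ordinal lt)) //= addKn leq_addr.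
Qed.

(** Choosing a points in each of d disjoint sets of size n is one way to choose
    da points among dn. *)
Lemma leq_bin_exp n a d : 'C(n, a) ^ d <= 'C(d * n, d * a).
Proof.
elim: d => [|d IHd]; first by rewrite !mul0n bin0.
rewrite expnS !mulSn; apply: leq_trans (leq_bin_mul _ _ _ _).
by rewrite leq_mul2l IHd orbT.
Qed.

Lemma double_fact_sqr k : (\prod_(i < k) i.*2.+1) ^ 2 <= k.*2`!.
Proof.
elim: k => [|k IHk]; first by rewrite big_ord0.
rewrite big_ord_recr /= expnMn doubleS !factS mulnA mulnC leq_mul //.
by rewrite -mulnn leq_mul.
Qed.

(** Each (M + 2i)^2 dominates (M + 2i)(M + 2i - 1). *)
Lemma rising_sqr M k : (M + k.*2 - 2) ^_ k.*2 <= (\prod_(i < k) (M + i.*2)) ^ 2.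
Proof.
elim: k => [|k IHk]; first by rewrite big_ord0.
rewrite big_ord_recr /= expnMn doubleS !ffactnS mulnA mulnC !addnS subSS subSS subn0 /=.
rewrite -mulnn leq_mul // ?leq_mul ?leq_pred //.
by move: IHk; rewrite -subn2.
Qed.

(** Squaring completes the odd numbers to (da)! and the other product to a
    falling factorial of length da, so the squared quotient is about
    1 / 'C(dn, da), which is at most 'C(n, a)^(-d). The subtracted constant
    shifts the falling factorial, and a shift by r changes it by the quotient of
    r factors close to dn by r factors close to db, at most 4^r. *)
Lemma cut_ratio d a b k : 3 <= d -> a <= b -> k.*2 = d * a ->
  2 * (blocked_pairs d).+2 <= d * b ->
  (\prod_(i < k) i.*2.+1) ^ 2 * 'C(a + b, a) ^ 3
  <= 4 ^ (blocked_pairs d).+2 * (\prod_(i < k) (d * b + i.*2 - blocked_pairs d)) ^ 2.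
Proof.
set c := blocked_pairs d => d3 ab ka cb.
have cdb : c <= d * b by lia.
rewrite [in leqRHS](eq_bigr (fun i : 'I_k => d * b - c + i.*2)) => [|i _];
  last by rewrite addnBAC.
apply: (@leq_trans (4 ^ c.+2 * (d * b - c + k.*2 - 2) ^_ k.*2)); last first.
  by rewrite leq_mul2l rising_sqr orbT.
apply: (@leq_trans ((d * (a + b)) ^_ k.*2)).
  rewrite ka -bin_ffact mulnC leq_mul //; last first.
    by apply: leq_trans (double_fact_sqr k) _; rewrite ka.
  apply: leq_trans (leq_bin_exp _ _ _); apply: leq_pexp2l => //.
  by rewrite bin_gt0 leq_addr.
have y0 : 0 < (d * b) ^_ c.+2 by rewrite ffact_gt0; lia.
rewrite -(leq_pmul2r y0).
have -> : d * b = d * (a + b) - k.*2 by rewrite ka; lia.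
rewrite -ffactD [k.*2 + _]addnC ffactD.
have -> : d * (a + b) - c.+2 = d * (a + b) - k.*2 - c + k.*2 - 2 by rewrite ka; lia.
rewrite mulnAC leq_mul2r; apply/orP; right.
apply: leq_ffact_exp4; rewrite ka mulnDr addKn.
have dab : d * a <= d * b by rewrite leq_mul2l ab orbT.
by lia.
Qed.

(** A path has degrees at most 2 and enough edges for every factor of the lower
    bound to be positive, so its degrees can be raised to d. *)
Lemma regular_graphs_gt0 n d : 2 <= d -> blocked_pairs d < n -> ~~ odd (n * d) ->
  0 < #|regular_graphs n d|.
Proof.
case: n => // n d2 nd ev.
pose next (u v : 'I_n.+1) := v == u.+1 :> nat.
pose G := [set [set p.1; p.2] | p in [set p : 'I_n.+1 * 'I_n.+1 | next p.1 p.2]].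
have adjP u v : adj G u v -> next u v || next v u.
  move=> /imsetP[[a b]]; rewrite inE /next /= => ab /setP E.
  have := E u; have := E v; have := E a; have := E b.
  by rewrite !inE !eqxx !orbT /= -!val_eqE /= (eqP ab); lia.
have sG : simple_graph G.
  apply/simple_graphP => _ /imsetP[[u v] + ->]; rewrite inE /next cards2 /= => /eqP uv.
  by case: eqVneq => // E; rewrite E in uv; lia.
have dG2 u : degree G u <= 2.
  rewrite -card_adj //; apply: (@leq_trans #|[set inord u.+1; inord u.-1 : 'I_n.+1]|).
    apply/subset_leq_card/subsetP => v; rewrite !inE => /adjP/orP[] /eqP E.
      by rewrite -E inord_val eqxx.
    by rewrite E /= inord_val eqxx orbT.
  by rewrite cards2; case: (_ != _).
have dG1 u : 1 <= degree G u.
  have n0 : 0 < n by move: nd; rewrite /blocked_pairs; case: (d) d2 => // d' _;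
    case: (n) => //; lia.
  rewrite -card_adj // card_gt0; apply/set0Pn.
  have [lt|ge] := ltnP u n.
    exists (inord u.+1); rewrite inE; apply/imsetP; exists (u, inord u.+1) => //.
    by rewrite inE /next /= inordK.
  exists (inord u.-1); rewrite inE; apply/imsetP; exists (inord u.-1, u);
    last by rewrite /= setUC.
  by have := ltn_ord u; rewrite inE /next /= => ?; rewrite inordK; lia.
have := @graphs_with_degrees_lower n.+1 d (n.+1 * d - \sum_u degree G u)./2 (degree
  G) (fun _ => d).
rewrite sum_nat_const card_ord -regular_graphsE => /(_ _ _ _)/wrap[].
- by move=> w; apply: leq_trans d2.
- by [].
- have le : \sum_u degree G u <= n.+1 * d.
    rewrite -[n.+1 in leqRHS]card_ord -sum_nat_const; apply: leq_sum => u _.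
    exact: leq_trans (dG2 u) d2.
  rewrite halfK oddB // (negPf ev) handshake // odd_double subn0 subnKC //.
  by rewrite -handshake.
have pos : 0 < #|graphs_with_degrees (degree G)| * \prod_w (degree G w)`!
    * \prod_(i < (n.+1 * d - \sum_u degree G u)./2) (\sum_w degree G w + i.*2 -
      blocked_pairs d).
  rewrite !muln_gt0 prodn_gt0 ?andbT => [|u]; last exact: fact_gt0.
  apply/andP; split.
    by rewrite card_gt0; apply/set0Pn; exists G; apply/graphs_with_degreesP.
  rewrite prodn_gt0 // => i; rewrite subn_gt0; apply: leq_trans nd _.
  apply: leq_trans (leq_addr _ _).
  by rewrite -[n.+1 in leqLHS]card_ord -sum1_card; apply: leq_sum.
by move/(leq_trans pos); rewrite muln_gt0 => /andP[].
Qed.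

(** By [cut_ratio] with d >= 3, the proportion of graphs split by A is
    O('C(n, |A|)^(-3/2)), and so it is O('C(n, |A|)^(-1/2)) for all sets of the
    size of A together. *)
Lemma card_cuts_of_size_sqr n d (A : {set 'I_n}) :
  3 <= d -> #|A|.*2 <= n -> 4 * (blocked_pairs d).+2 <= n ->
  ('C(n, #|A|) * (#|graphs_with_degrees (degree_on d A)|
      * #|graphs_with_degrees (degree_on d (~: A))|)) ^ 2 * 'C(n, #|A|)
  <= 4 ^ (blocked_pairs d).+2 * #|regular_graphs n d| ^ 2.
Proof.
move=> d3 An nc.
have cA : #|A| + #|~: A| = n by rewrite cardsC card_ord.
have [->|[G /graphs_with_degreesP[sG dG]]] :=
  set_0Vmem (graphs_with_degrees (degree_on d A)).
  by rewrite cards0 mul0n muln0.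
(* The handshake lemma makes d * #|A| even as soon as one such graph exists. *)
have dA : #|G|.*2 = d * #|A|.
  by rewrite -handshake // -sum_degree_on; apply: eq_bigr => w _.
have := card_graphs_cut dA.
have AB : #|A| <= #|~: A|.
  by move: #|A| #|~: A| cA An => a b <-; rewrite -addnn leq_add2l.
have dB : 2 * (blocked_pairs d).+2 <= d * #|~: A|.
  have nB : n <= 2 * #|~: A|.
    by move: #|A| #|~: A| cA AB => a b <-; lia.
  have dB' : 3 * #|~: A| <= d * #|~: A| by rewrite leq_mul2r d3 orbT.
  by move: #|~: A| nB dB' => b; lia.
have := cut_ratio d3 AB dA dB; rewrite cA.
set P := \prod_(i < _) _; set Q := \prod_(i < _) _.
set T := _ * #|graphs_with_degrees _|; set N := #|regular_graphs n d|;
  set C := 'C(n, _).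
set K := 4 ^ _ => ratio cut.
have Q0 : 0 < Q ^ 2.
  rewrite expn_gt0 prodn_gt0 // => i; rewrite subn_gt0; apply: leq_trans (leq_addr _ _).
  by apply: leq_trans dB; lia.
rewrite -(leq_pmul2r Q0).
apply: (@leq_trans ((N * P) ^ 2 * C ^ 3)).
  apply: (@leq_trans ((T * Q) ^ 2 * C ^ 3));
    last by rewrite leq_mul2r leq_exp2r // cut orbT.
  by apply: eq_leq; ring.
apply: (@leq_trans (N ^ 2 * (K * Q ^ 2))); last by apply: eq_leq; ring.
by rewrite expnMn -mulnA leq_mul2l ratio orbT.
Qed.

Lemma bin_add_sym a b : 'C(b + a, b) = 'C(b + a, a).
Proof. by rewrite -[RHS]bin_sub ?leq_addl // addnK. Qed.

(** With b = n - a, the number 'C(b + a, b) increases with a; so sizes a >= j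
    give at least 'C(b + j, b), of order n^j. *)
Lemma leq_bin_linear n a : 1 <= a -> a.*2 <= n -> n <= 4 * 'C(n, a).
Proof.
move=> a1 an; have [b nE] : exists b, n = b + a by exists (n - a); lia.
have : 'C(b + 1, b) <= 'C(b + a, b) by apply: leq_bin2l; lia.
by rewrite !bin_add_sym bin1 nE; lia.
Qed.

Lemma leq_bin_cubic n a : 3 <= a -> a.*2 <= n -> n ^ 3 <= 49 * 'C(n, a).
Proof.
move=> a1 an; have [b nE] : exists b, n = b + a by exists (n - a); lia.
have : 'C(b + 3, b) <= 'C(b + a, b) by apply: leq_bin2l; lia.
rewrite nE !bin_add_sym => le.
have ba : (b + a) ^ 3 <= 8 * b ^ 3.
  by rewrite -[8]/(2 ^ 3) -expnMn leq_exp2r //; lia.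
have : b ^ 3 <= (b + 3) ^_ 3.
  by rewrite ffact_prod -[X in b ^ X]card_ord -prod_nat_const;
    apply: leq_prod => i _; have := ltn_ord i; lia.
rewrite -bin_ffact -[3`!]/6; lia.
Qed.

Local Open Scope ring_scope.

(** * A random regular graph is connected *)

Lemma sum_set_by_card (R : realType) n (P : pred nat) (g : nat -> R) :
  \sum_(A : {set 'I_n} | P #|A|) g #|A| = \sum_(a < n.+1 | P a) 'C(n, a)%:R * g a.
Proof.
have leA (A : {set 'I_n}) :
  (#|A| < n.+1)%N by rewrite ltnS -[n in leqRHS]card_ord max_card.
rewrite (partition_big (fun A : {set 'I_n} => inord #|A| : 'I_n.+1) (fun a =>
  P a)) => [|A PA]; last by rewrite inordK.
apply: eq_bigr => a Pa.
rewrite (eq_bigl (fun A : {set 'I_n} => #|A| == a)) => [|A].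
  rewrite (eq_bigr (fun _ => g a)) => [|A /eqP -> //].
  rewrite sumr_const -[LHS]mulr_natl; congr (_ * _); congr (1 *+ _).
  rewrite -[n in 'C(n, _)]card_ord -card_draws; apply: eq_card => A.
  by rewrite inE.
rewrite -(inj_eq val_inj) /= inordK //; case: eqP => [->|]; first by rewrite Pa.
by rewrite andbF.
Qed.

Lemma ler_of_sqr (R : realDomainType) (x y : R) : 0 <= y -> x ^+ 2 <= y ^+ 2 -> x <= y.
Proof.
move=> y0 le; have [x0|x0] := lerP 0 x; last exact: le_trans (ltW x0) y0.
by rewrite -(@ler_pXn2r _ 2) ?nnegrE.
Qed.

(** Union bound over the smaller side of a cut. The sizes 1 and 2 contribute
    O(n^(-1/2)) each, and the at most n other ones O(n^(-3/2)) each. *)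
Lemma card_disconnected_small (R : realType) d : (3 <= d)%N ->
  exists K : R, forall n, (4 * (blocked_pairs d).+2 <= n)%N ->
    #|[set G in regular_graphs n d | ~~ connected_graph G]|%:R * Num.sqrt n%:R
    <= K * #|regular_graphs n d|%:R :> R.
Proof.
move=> d3; pose K0 : R := (4 ^ (blocked_pairs d).+2)%:R.
exists (11 * Num.sqrt K0) => n nc.
have K00 : 0 <= K0 by rewrite ler0n.
set s := Num.sqrt n%:R; set k := Num.sqrt K0; set N := #|regular_graphs n d|.
have s0 : 0 <= s by exact: sqrtr_ge0.
have k0 : 0 <= k by exact: sqrtr_ge0.
have n0 : (0 < n)%N by apply: leq_trans nc.
have n0R : 0 < n%:R :> R by rewrite ltr0n.
have s2 : s ^+ 2 = n%:R by rewrite sqr_sqrtr.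
have k2 : k ^+ 2 = K0 by rewrite sqr_sqrtr.
pose t (A : {set 'I_n}) := (#|graphs_with_degrees (degree_on d A)|
       * #|graphs_with_degrees (degree_on d (~: A))|)%N.
(* After multiplication by sqrt n, all sets of size a together contribute at
   most h a times the constant; the h a sum to at most 2 * 2 + n * (7 / n). *)
pose h a : R := (if (a <= 2)%N then 2 else 0) + 7 / n%:R.
have h0 a : 0 <= h a by rewrite /h addr_ge0 ?divr_ge0 //; case: ifP.
have tA (A : {set 'I_n}) : (0 < #|A|)%N && (#|A|.*2 <= n)%N ->
    (t A)%:R * s <= k * N%:R * (h #|A| / 'C(n, #|A|)%:R).
  move=> /andP[A0 An].
  have : ('C(n, #|A|)%:R * (t A)%:R) ^+ 2 * 'C(n, #|A|)%:R <= k ^+ 2 * N%:R ^+ 2 :> R.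
    by rewrite k2 -natrM -!natrX -!natrM ler_nat card_cuts_of_size_sqr.
  have C0 : 0 < 'C(n, #|A|)%:R :> R by rewrite ltr0n bin_gt0; lia.
  set C := 'C(n, _)%:R in C0 *; set T := (t A)%:R; set M := N%:R => le.
  rewrite mulrA ler_pdivlMr //.
  have M0 : 0 <= M by rewrite ler0n.
  suff : C * T * s <= k * M * h #|A| by rewrite -mulrA mulrC.
  have [a2|a3] := leqP #|A| 2.
    apply: (@le_trans _ _ (2 * (k * M))); last first.
      rewrite mulrC ler_wpM2l ?mulr_ge0 // /h a2 lerDl divr_ge0 //.
    apply: ler_of_sqr; first by rewrite !mulr_ge0.
    have := leq_bin_linear A0 An; rewrite -(ler_nat R) natrM -/C -s2 => sC.
    rewrite exprMn; apply: (@le_trans _ _ ((C * T) ^+ 2 * (4 * C))).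
      by rewrite ler_wpM2l // sqr_ge0.
    lra.
  apply: (@le_trans _ _ (7 / n%:R * (k * M))); last first.
    rewrite mulrC ler_wpM2l ?mulr_ge0 // /h leqNgt a3 /= add0r //.
  rewrite [leRHS]mulrAC ler_pdivlMr //.
  apply: ler_of_sqr; first by rewrite !mulr_ge0.
  have := leq_bin_cubic a3 An; rewrite -(ler_nat R) natrM natrX -/C => sC.
  rewrite exprMn [(C * T * s) ^+ 2]exprMn s2 -mulrA -exprS.
  apply: (@le_trans _ _ ((C * T) ^+ 2 * (49 * C))).
    by rewrite ler_wpM2l // sqr_ge0.
  lra.
apply: (@le_trans _ _ ((\sum_(A :
  {set 'I_n} | (0 < #|A|)%N && (#|A|.*2 <= n)%N) (t A)%:R) * s)).
  by rewrite ler_wpM2r // -natr_sum ler_nat card_disconnected_le.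
rewrite mulr_suml; apply: le_trans (ler_sum _ tA) _.
rewrite -mulr_sumr -[leRHS]mulrA [leRHS]mulrC ler_wpM2l ?mulr_ge0 //.
rewrite (sum_set_by_card _ (fun a => (0 < a)%N && (a.*2 <= n)%N) (fun a =>
  h a / 'C(n, a)%:R)).
apply: (@le_trans _ _ (\sum_(a < n.+1 | (0 < a)%N) h a)).
  rewrite big_mkcondr /=; apply: ler_sum => a a0; case: ifP => // an.
  by rewrite mulrC divfK // pnatr_eq0 -lt0n bin_gt0; lia.
rewrite big_mkcond big_ord_recl /= add0r.
rewrite (eq_bigr (fun i : 'I_n =>
  h i.+1)) // big_split /= sumr_const card_ord -[X in _ + X]mulr_natr.
rewrite divfK ?gt_eqF //.
have -> : 11 = 4 + 7 :> R by rewrite -natrD.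
rewrite lerD2r.
have [n' nE] : exists n', n = n'.+2 by exists n.-2; lia.
rewrite nE !big_ord_recl /= big1 => [|i _]; last by [].
by rewrite addr0 -natrD.
Qed.

Local Open Scope nat_scope.

(** * Joint edge counts, by symmetry under relabelling *)

(** Hence the number of regular graphs that contain given edges depends only on
    how these edges overlap. *)
Lemma perm_extends (T : finType) (s t : seq T) :
  uniq s -> uniq t -> size s = size t -> exists p : {perm T}, map p s = t.
Proof.
elim: s t => [|x s IHs] [|y t] //=; first by exists 1%g.
move=> /andP[xs us] /andP[yt ut] [st].
have [p pE] := IHs _ us ut st.
exists (p * tperm (p x) y)%g; rewrite permM tpermL; congr (_ :: _).
rewrite -pE; apply/eq_in_map => z zs; rewrite permM tpermD //.
  by rewrite (inj_eq perm_inj); apply: contraNneq xs => ->.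
by apply: contraNneq yt => ->; rewrite -pE map_f.
Qed.

Definition relabel n (s : {perm 'I_n}) (G : edge_set n) : edge_set n :=
  [set s @: (e : {set 'I_n}) | e in G].

Lemma adj_relabel n (s : {perm 'I_n}) (G : edge_set n) u v :
  adj (relabel s G) (s u) (s v) = adj G u v.
Proof.
have -> : adj (relabel s G) (s u) (s v) = (s @: [set u; v] \in relabel s G).
  by rewrite imsetU1 imset_set1.
by rewrite mem_imset //; apply: imset_inj; exact: perm_inj.
Qed.

Lemma relabel_inj n (s : {perm 'I_n}) : injective (@relabel n s).
Proof. by apply/imset_inj/imset_inj/perm_inj. Qed.

Lemma relabel_regular n d (s : {perm 'I_n}) (G : edge_set n) :
  G \in regular_graphs n d -> relabel s G \in regular_graphs n d.
Proof.
rewrite !inE => /andP[/simple_graphP sG /forallP dG]; apply/andP; split.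
  by apply/simple_graphP => _ /imsetP[e eG ->]; rewrite card_imset ?sG //;
    exact: perm_inj.
apply/forallP => u; rewrite -[u](permKV s) -(eqP (dG (s^-1%g u))).
rewrite -(card_imset [set v | adj G (s^-1%g u) v] (@perm_inj _ s)).
apply/eqP/eq_card => v; rewrite inE.
by rewrite -[v](permKV s) adj_relabel mem_imset ?inE //; exact: perm_inj.
Qed.

Definition card_two_edges n d (u v a b : 'I_n) :=
  #|[set G in regular_graphs n d | adj G u v && adj G a b]|.

Lemma card_two_edges_relabel n d (s : {perm 'I_n}) (u v a b : 'I_n) :
  card_two_edges d u v a b <= card_two_edges d (s u) (s v) (s a) (s b).
Proof.
rewrite /card_two_edges -(card_imset _ (@relabel_inj _ s)).
apply/subset_leq_card/subsetP => _ /imsetP[G + ->]; rewrite inE => /andP[rG ad].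
by rewrite inE !adj_relabel ad relabel_regular.
Qed.

Definition card_edge n d (u v : 'I_n) := #|[set G in regular_graphs n d | adj G u v]|.

Lemma card_edgeE n d (u v : 'I_n) : card_edge d u v = card_two_edges d u v u v.
Proof. by apply: eq_card => G; rewrite !inE andbb. Qed.

Lemma card_adj_regular n d (G : edge_set n) u :
  G \in regular_graphs n d -> \sum_v adj G u v = d.
Proof.
rewrite regular_graphsE => /graphs_with_degreesP[sG dG].
by rewrite -(dG u) -card_adj // -sum1dep_card [RHS]big_mkcond;
  apply: eq_bigr => v _; case: (adj G u v).
Qed.

(** All edges at u are equally frequent, and every graph has d of them. *)
Lemma card_edge_regular n d (u v : 'I_n) : u != v ->
  card_edge d u v * n.-1 = d * #|regular_graphs n d|.
Proof.
move=> uv; transitivity (\sum_(w | w != u) card_edge d u w).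
  rewrite (eq_bigr (fun _ => card_edge d u v)) => [|w wu].
    by rewrite sum_nat_const (cardC1 u) card_ord mulnC.
  rewrite !card_edgeE; apply/eqP; rewrite eqn_leq; apply/andP; split.
    have [|||p [pu pv]] := @perm_extends _ [:: u; w] [:: u; v];
      rewrite //= ?inE ?andbT ?uv // 1?eq_sym //.
    by have := card_two_edges_relabel d p u w u w; rewrite pu pv.
  have [|||p [pu pv]] := @perm_extends _ [:: u; v] [:: u; w];
      rewrite //= ?inE ?andbT ?uv // 1?eq_sym //.
  by have := card_two_edges_relabel d p u v u v; rewrite pu pv.
rewrite mulnC -sum_nat_const.
under eq_bigr => w _ do rewrite /card_edge -sum1dep_card big_mkcondr /=.
rewrite exchange_big /=; apply: eq_bigr => G rG.
rewrite -(card_adj_regular u rG) [in RHS](bigD1 u) //=.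
have -> : adj G u u = false.
  by apply/negP => uu; move: rG; rewrite inE => /andP[/adj_neq/(_ uu)]; rewrite eqxx.
rewrite add0n; by apply: eq_bigr => w _; case: (adj G u w).
Qed.

Lemma sum_card_two_edges n d (u v : 'I_n) (P : pred ('I_n * 'I_n)) :
  \sum_(p | P p) card_two_edges d u v p.1 p.2
  = \sum_(G in [set G in regular_graphs n d | adj G u v]) \sum_(p | P p) adj G p.1 p.2.
Proof.
rewrite exchange_big /=; apply: eq_bigr => p _.
rewrite /card_two_edges -sum1dep_card [RHS]big_mkcond [LHS]big_mkcond;
  apply: eq_bigr => G _.
rewrite [X in _ = if X then _ else _]in_set.
by case: (G \in _) => //=; case: (adj G u v) => //=; case: (adj G _ _).
Qed.

(** Averaging over b: a graph that contains uv has at most d edges at u. *)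
Lemma card_two_edges_path n d (u v b : 'I_n) : u != v -> b != u -> b != v ->
  card_two_edges d u v u b * (n - 2) <= card_edge d u v * d.
Proof.
move=> uv bu bv.
pose P := [pred p : 'I_n * 'I_n | (p.1 == u) && (p.2 \notin [set u; v])].
have := sum_card_two_edges d u v P.
have sumP (F : 'I_n -> 'I_n -> nat) :
    \sum_(p | P p) F p.1 p.2 = \sum_(c in ~: [set u; v]) F u c.
  rewrite (eq_bigl (fun p => (p.1 == u) && (p.2 \in ~: [set u; v]))) => [|p].
    by rewrite -(pair_big (fun a => a == u) (fun c => c \in ~: [set u;
      v])) big_pred1_eq.
  by rewrite !inE.
rewrite (sumP (card_two_edges d u v)) => sumE.
apply: (@leq_trans (\sum_(c in ~: [set u; v]) card_two_edges d u v u c)).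
  rewrite mulnC; have -> : n - 2 = #|~: [set u; v]|.
    by rewrite cardsCs setCK card_ord cards2 uv.
  rewrite -sum_nat_const; apply: leq_sum => c; rewrite !inE negb_or => /andP[cu cv].
  have [|||p [pu pv pb]] := @perm_extends _ [:: u; v; b] [:: u; v; c];
      rewrite //= ?inE ?andbT ?negb_or ?uv /=;
        try by rewrite ![u == _]eq_sym ![v == _]eq_sym ?bu ?bv ?cu ?cv.
  by have := card_two_edges_relabel d p u v u b; rewrite pu pv pb.
rewrite sumE -sum_nat_const; apply: leq_sum => G; rewrite inE => /andP[rG _].
rewrite (sumP (fun a b =>
  adj G a b : nat)) -[leqRHS](card_adj_regular u rG) big_mkcond /=.
by apply: leq_sum => c _; case: ifP.
Qed.

(** Averaging over (a, b): a graph has nd ordered adjacent pairs. *)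
Lemma card_two_edges_disjoint n d (u v a b : 'I_n) : uniq [:: u; v; a; b] ->
  card_two_edges d u v a b * ((n - 2) * (n - 3)) <= card_edge d u v * (n * d).
Proof.
move=> uq.
pose P := [pred p : 'I_n * 'I_n | uniq [:: u; v; p.1; p.2]].
have uv : u != v by move: uq => /=; rewrite inE negb_or => /andP[/andP[]].
have card_lt3 c : c \notin [set u; v] -> #|~: (c |: [set u; v])| = n - 3.
  by move=> cuv; rewrite cardsCs setCK card_ord cardsU1 cuv cards2 uv.
have cardP : #|[set p | P p]| = (n - 2) * (n - 3).
  rewrite card_sections.
  have -> : n - 2 = #|~: [set u; v]| by rewrite cardsCs setCK card_ord cards2 uv.
  rewrite -sum_nat_const [RHS]big_mkcond; apply: eq_bigr => c _.
  rewrite in_setC; case: ifP => [cuv|/negbFE cuv].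
    rewrite -(card_lt3 c cuv); apply: eq_card => e; move: cuv;
      rewrite !inE /= !inE !negb_or.
    rewrite uv /= [c == u]eq_sym [c == v]eq_sym [e == c]eq_sym [e == u]eq_sym [e ==
      v]eq_sym.
    by move=> /andP[-> ->] /=; case: (u == e); case: (v == e); case: (c == e).
  apply/eqP; rewrite cards_eq0; apply/eqP/setP => e; rewrite !inE /= !inE.
  by move: cuv; rewrite !inE [c == u]eq_sym [c == v]eq_sym => /orP[] ->;
    rewrite ?orbT /= ?andbF.
rewrite -cardP mulnC -sum_nat_const.
apply: (@leq_trans (\sum_(p | P p) card_two_edges d u v p.1 p.2)).
  rewrite (eq_bigl P) => [|p]; last by rewrite inE.
  apply: leq_sum => -[c e] uq'.
  have [//|//|//|p [pu pv pa pb]] := @perm_extends _ [:: u; v; a; b] [:: u; v; c; e].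
  by have := card_two_edges_relabel d p u v a b; rewrite pu pv pa pb.
rewrite sum_card_two_edges -sum_nat_const; apply: leq_sum => G;
  rewrite inE => /andP[rG _].
apply: (@leq_trans (\sum_p adj G p.1 p.2)).
  by rewrite [leqRHS](bigID P) leq_addr.
rewrite -(pair_bigA _ (fun a b => adj G a b : nat)) /= (eq_bigr (fun _ => d)) => [|w _].
  by rewrite sum_nat_const card_ord.
exact: card_adj_regular.
Qed.

Lemma card_two_edgesC n d (u v a b : 'I_n) :
  card_two_edges d u v a b = card_two_edges d v u a b.
Proof. by apply: eq_card => G; rewrite !inE (adjC G u v). Qed.

Lemma card_two_edgesCr n d (u v a b : 'I_n) :
  card_two_edges d u v a b = card_two_edges d u v b a.
Proof. by apply: eq_card => G; rewrite !inE (adjC G a b). Qed.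

Lemma card_edgeC n d (u v : 'I_n) : card_edge d u v = card_edge d v u.
Proof. by apply: eq_card => G; rewrite !inE (adjC G u v). Qed.

(** Edges sharing a vertex satisfy the bound of the disjoint ones, so that two
    distinct edges are together present with probability at most
    p^2 (1 + O(1/n)), where p is the probability of one edge. *)
Lemma card_two_edges_bound n d (u v a b : 'I_n) :
  u != v -> a != b -> (a, b) != (u, v) -> (a, b) != (v, u) ->
  card_two_edges d u v a b * ((n - 2) * (n - 3)) <= card_edge d u v * (n * d).
Proof.
rewrite !xpair_eqE !negb_and => uv ab abuv abvu.
have path (x y c : 'I_n) : x != y -> c != x -> c != y ->
    card_two_edges d x y x c * ((n - 2) * (n - 3)) <= card_edge d x y * (n * d).
  move=> xy cx cy; rewrite mulnA [n * d]mulnC mulnA leq_mul ?leq_subr //.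
  exact: card_two_edges_path.
have [au|au] := eqVneq a u.
  move: ab abuv; rewrite au eqxx /= eq_sym => bu bv; exact: path.
have [av|av] := eqVneq a v.
  rewrite card_two_edgesC card_edgeC; move: ab abvu.
  by rewrite av eqxx /= eq_sym => bv bu; apply: path; rewrite // eq_sym.
have [bu|bu] := eqVneq b u.
  by rewrite bu card_two_edgesCr; apply: path.
have [bv|bv] := eqVneq b v.
  by rewrite bv card_two_edgesCr card_two_edgesC card_edgeC; apply: path;
    rewrite // eq_sym.
apply: card_two_edges_disjoint.
by rewrite /= !inE !negb_or uv ab andbT ![u == _]eq_sym ![v == _]eq_sym au av bu bv.
Qed.

Local Open Scope ring_scope.

(** * Concentration of weighted edge sums *)

Lemma sum_pairs (V : nmodType) (I : finType) (F : I * I -> V) :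
  \sum_p F p = \sum_u \sum_v F (u, v).
Proof. by rewrite pair_bigA /=; apply: eq_bigr => -[]. Qed.

Definition edge_sum (R : realType) n (F : 'I_n * 'I_n -> R) (G : edge_set n) : R :=
  \sum_p F p * (adj G p.1 p.2)%:R.

Definition edge_probability (R : realType) n d : R := d%:R / (n%:R - 1).

Lemma card_edge_probability (R : realType) n d (u v : 'I_n) : (1 < n)%N -> u != v ->
  (card_edge d u v)%:R = edge_probability R n d * #|regular_graphs n d|%:R.
Proof.
move=> n1 uv; have := card_edge_regular d uv => /(congr1 (fun k => k%:R : R)).
have n1R : 1 < n%:R :> R by rewrite ltr1n.
have n1E : (n.-1)%:R = n%:R - 1 :> R by rewrite -subn1 natrB // ltnW.
rewrite !natrM n1E /edge_probability mulrAC => <-; rewrite mulfK //; lra.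
Qed.

Lemma sumr_indicator (R : pzSemiRingType) (T : finType) (S : {set T}) (P : pred T) :
  \sum_(x in S) (P x)%:R = #|[set x in S | P x]|%:R :> R.
Proof.
rewrite -sum1dep_card natr_sum big_mkcondr /=; apply: eq_bigr => G _.
by case: (P G).
Qed.

Lemma edge_sum_mean (R : realType) n d (F : 'I_n * 'I_n -> R) :
  (1 < n)%N -> (forall u, F (u, u) = 0) ->
  \sum_(G in regular_graphs n d) edge_sum F G
  = #|regular_graphs n d|%:R * (edge_probability R n d * \sum_p F p).
Proof.
move=> n1 F0; rewrite exchange_big /= mulrA mulr_sumr; apply: eq_bigr => -[u v] _ /=.
rewrite -mulr_sumr sumr_indicator -/(card_edge d u v).
have [->|uv] := eqVneq u v; first by rewrite F0 mul0r mulr0.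
by rewrite card_edge_probability // mulrC; congr (_ * _); rewrite mulrC.
Qed.

(** The summand with M comes from the two ordered pairs p and q that are the
    same edge; the other products use [card_two_edges_bound]. *)
Lemma edge_sum_second_moment (R : realType) n d (F : 'I_n * 'I_n -> R) (M : R) :
  (3 < n)%N -> (forall u, F (u, u) = 0) -> (forall p, 0 <= F p <= M) ->
  \sum_(G in regular_graphs n d) edge_sum F G ^+ 2
  <= #|regular_graphs n d|%:R * edge_probability R n d *
     (n%:R * d%:R / ((n%:R - 2) * (n%:R - 3)) * (\sum_p F p) ^+ 2 + 2 * M * \sum_p F p).
Proof.
move=> n3 F0 FM; set N := #|_|%:R; set pr := edge_probability R n d;
  set T := \sum_p F p.
set Q := n%:R * d%:R / _.
have n3R : 3 < n%:R :> R by rewrite (ltr_nat R 3).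
have pr0 : 0 <= N * pr by rewrite !mulr_ge0 // invr_ge0; lra.
have Q0 : 0 <= N * pr * Q.
  by rewrite mulr_ge0 // divr_ge0 ?mulr_ge0 //; nra.
pose c (p q : 'I_n * 'I_n) : R := (card_two_edges d p.1 p.2 q.1 q.2)%:R.
have sqE : \sum_(G in regular_graphs n d) edge_sum F G ^+ 2
    = \sum_p \sum_q F p * F q * c p q.
  transitivity (\sum_(G in regular_graphs n d) \sum_p \sum_q
     F p * F q * ((adj G p.1 p.2 && adj G q.1 q.2)%:R)).
    apply: eq_bigr => G _; rewrite expr2 mulr_suml; apply: eq_bigr => p _.
    rewrite mulr_sumr; apply: eq_bigr => q _; rewrite -mulnb natrM; ring.
  rewrite exchange_big; apply: eq_bigr => p _.
  rewrite exchange_big; apply: eq_bigr => q _.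
  by rewrite -mulr_sumr sumr_indicator.
pose sw (p : 'I_n * 'I_n) := (p.2, p.1).
have le p q : F p * F q * c p q
   <= N * pr * (Q * (F p * F q) + F p * (F q * ((q == p)%:R + (q == sw p)%:R))).
  have F_ge0 x : 0 <= F x by case/andP: (FM x).
  have [p0|pp] := eqVneq p.1 p.2.
    by case: p p0 => u v /= ->; rewrite F0 !mul0r !mulr0 addr0 mulr0.
  have [q0|qq] := eqVneq q.1 q.2.
    by case: q q0 => u v /= ->; rewrite F0 !(mul0r, mulr0) addr0 mulr0.
  have FF : 0 <= F p * F q by rewrite mulr_ge0.
  rewrite (_ : _ * (_ + _) =
    F p * F q * (N * pr * (Q + ((q == p)%:R + (q == sw p)%:R)))); last by ring.
  rewrite ler_wpM2l //.
  have cE : (card_edge d p.1 p.2)%:R =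
    N * pr by rewrite card_edge_probability 1?mulrC // ltnW // ltnW.
  have [qp|qp] := boolP ((q == p) || (q == sw p)).
    apply: (@le_trans _ _ (N * pr)).
      by rewrite -cE ler_nat subset_leq_card //; apply/subsetP => G;
        rewrite !inE => /and3P[-> -> _].
    rewrite mulrDr -[leLHS]add0r lerD // -[leLHS]mulr1 ler_wpM2l //.
    by move: qp; case: (q == p); case: (q == sw p) => //= _; lra.
  move: qp; rewrite negb_or => /andP[/negPf qp /negPf qs].
  rewrite qp qs addr0 addr0.
  have := @card_two_edges_bound n d p.1 p.2 q.1 q.2 pp qq.
  rewrite -!surjective_pairing qp -/(sw p) qs => /(_ isT isT).
  rewrite -(ler_nat R) !natrM cE !natrB; [|lia|lia].
  by move=> bnd; rewrite /Q mulrA ler_pdivlMr //; nra.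
rewrite sqE; apply: (@le_trans _ _ (\sum_p \sum_q
   (N * pr * (Q * (F p * F q) + F p * (F q * ((q == p)%:R + (q == sw p)%:R)))))).
  by apply: ler_sum => p _; apply: ler_sum => q _.
under eq_bigr => p _ do rewrite -mulr_sumr big_split /= -mulr_sumr -mulr_sumr
  -mulr_sumr.
rewrite -mulr_sumr ler_wpM2l // big_split /= -mulr_sumr -mulr_suml -/T -expr2 lerD2l.
rewrite mulr_sumr; apply: ler_sum => p _; rewrite mulrC.
have /andP[Fp0 FpM] := FM p; rewrite ler_wpM2r //.
under eq_bigr => q _ do rewrite mulrDr.
rewrite big_split /= mulr2n mulrDl mul1r lerD //.
  rewrite (bigD1 p) //= eqxx mulr1 big1 ?addr0 // => q /negPf ->; exact: mulr0.
rewrite (bigD1 (sw p)) //= eqxx mulr1 big1 ?addr0 //; first by case/andP: (FM (sw p)).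
by move=> q /negPf ->; exact: mulr0.
Qed.

(** Chebyshev's inequality: the variance is at most 10 mu^2 / n + 2 M mu, where
    mu = d T / (n - 1) is the mean and T the sum of F, and the threshold lies
    below mu / 2. *)
Lemma edge_sum_concentrated (R : realType) n d (F : 'I_n * 'I_n -> R) (M : R) :
  (5 < n)%N -> (0 < d)%N -> (forall u, F (u, u) = 0) -> (forall p, 0 <= F p <= M) ->
  0 < \sum_p F p ->
  #|[set G in regular_graphs n d | edge_sum F G < d%:R * (\sum_p F p) / (2 * n%:R)]|%:R
  <= #|regular_graphs n d|%:R * (40 / n%:R + 8 * M * n%:R / (d%:R * \sum_p F p)).
Proof.
move=> n5 d0 F0 FM; set T := \sum_p F p => T0; set N := #|regular_graphs n d|%:R.
have n5R : 6 <= n%:R :> R by rewrite (ler_nat R 6).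
have d0R : 0 < d%:R :> R by rewrite ltr0n.
have N0 : 0 <= N :> R by rewrite ler0n.
have mean := edge_sum_mean d (ltnW (ltnW (ltnW (ltnW n5)))) F0.
have second := edge_sum_second_moment d (ltnW (ltnW n5)) F0 FM.
rewrite -/T -/N in mean second.
pose mu : R := edge_probability R n d * T.
have pr0 : 0 < edge_probability R n d by rewrite divr_gt0 //; lra.
have dT_ge0 : 0 <= d%:R * T by rewrite mulr_ge0 // ltW.
have mu0 : 0 < mu by rewrite mulr_gt0.
have M0 : 0 <= M.
  have /set0Pn[p _] : [set: 'I_n * 'I_n] != finset.set0.
    by rewrite -card_gt0 cardsT card_prod card_ord; nia.
  by case/andP: (FM p) => /le_trans h /h.
have var : \sum_(G in regular_graphs n d) (edge_sum F G - mu) ^+ 2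
    <= N * (10 / n%:R * mu ^+ 2 + 2 * M * mu).
  under eq_bigr => G _ do rewrite sqrrB.
  rewrite big_split sumrB /= sumr_const.
  under [X in _ - X + _]eq_bigr => G _ do rewrite -mulr_natr mulrAC.
  rewrite -mulr_suml -mulr_suml mean -[X in _ + X]mulr_natr -/N -/mu.
  apply: (@le_trans _ _ (N * edge_probability R n d *
     (n%:R * d%:R / ((n%:R - 2) * (n%:R - 3)) * T ^+ 2 + 2 * M * T) - N * mu ^+ 2)).
    move: second; set S := \sum_(G in _) _ => second; nra.
  have -> : N * edge_probability R n d *
     (n%:R * d%:R / ((n%:R - 2) * (n%:R - 3)) * T ^+ 2 + 2 * M * T) - N * mu ^+ 2
    = N * ((n%:R * (n%:R - 1) / ((n%:R - 2) * (n%:R - 3)) - 1) * mu ^+ 2 + 2 * M * mu).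
    rewrite /mu /edge_probability; field.
    by apply/and3P; split; apply/eqP => h; lra.
  rewrite ler_wpM2l // lerD2r ler_wpM2r ?sqr_ge0 //.
  rewrite lerBlDr (_ : 10 / n%:R + 1 = (10 + n%:R) / n%:R); last by field;
    apply/eqP => h; lra.
  rewrite ler_pdivrMr; last by rewrite mulr_gt0; lra.
  rewrite mulrAC ler_pdivlMr; last lra.
  nra.
set B := [set G in _ | _].
have lower : #|B|%:R * (mu ^+ 2 / 4) <=
  \sum_(G in regular_graphs n d) (edge_sum F G - mu) ^+ 2.
  apply: (@le_trans _ _ (\sum_(G in B) (edge_sum F G - mu) ^+ 2)); last first.
    rewrite [leRHS](big_setID B) /= -[leLHS]addr0 lerD //.
      rewrite (_ : _ :&: B = B) //; apply/setIidPr/subsetP => G;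
        by rewrite inE => /andP[].
    by apply: sumr_ge0 => G _; rewrite sqr_ge0.
  rewrite mulr_natl -sumr_const; apply: ler_sum => G; rewrite inE => /andP[_ small].
  have : edge_sum F G <= mu / 2.
    apply: le_trans (ltW small) _; rewrite /mu /edge_probability.
    rewrite [leRHS](_ : _ = d%:R * T / (2 * (n%:R - 1))); last by field;
      apply/eqP => h; lra.
    rewrite ler_wpM2l // lef_pV2 ?posrE; lra.
  move=> h; nra.
have mu20 : 0 < mu ^+ 2 / 4 by rewrite divr_gt0 // exprn_gt0.
rewrite -(ler_pM2r mu20); apply: le_trans lower (le_trans var _).
rewrite -[leRHS]mulrA ler_wpM2l // [leRHS]mulrDl lerD //.
  by rewrite le_eqVlt; apply/orP; left; apply/eqP; field; lra.
have mu_le : d%:R * T / n%:R <= mu.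
  rewrite /mu /edge_probability [leRHS]mulrAC ler_wpM2l // lef_pV2 ?posrE; lra.
have dT0 : 0 < d%:R * T by rewrite mulr_gt0.
rewrite [leRHS](_ : _ = 2 * M * mu * (n%:R * mu / (d%:R * T))); last first.
  by field; rewrite !gt_eqF //.
have Mmu : 0 <= 2 * M * mu by apply: mulr_ge0; [apply: mulr_ge0 | apply: ltW].
rewrite -[leLHS]mulr1 ler_wpM2l //.
rewrite ler_pdivlMr // mul1r; move: mu_le; rewrite ler_pdivrMr //; last lra.
by rewrite [n%:R * mu]mulrC.
Qed.

(** * The inequality for a fixed connected target graph *)

(** A shortest walk can be reversed. *)
Lemma gdistC (T : finType) (e : rel T) x y :
  symmetric e -> connect e x y -> gdist e x y = gdist e y x.
Proof.
move=> es; suff le a b : connect e a b -> (gdist e b a <= gdist e a b)%N.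
  by move=> xy; apply/eqP; rewrite eqn_leq !le // sym_connect_sym.
move=> /gdistP[p [ep lp <-]].
have rp : path e b (rev (belast a p)).
  by rewrite -lp rev_path (eq_path (e' := e)) // => u v; rewrite es.
have := gdist_min rp; rewrite size_rev size_belast.
suff -> : last b (rev (belast a p)) = a by [].
by case: p {ep rp} lp => //= c p lp; rewrite rev_cons last_rcons.
Qed.

Lemma gdist_triangle (T : finType) (e : rel T) x y z :
  connect e x y -> connect e y z -> (gdist e x z <= gdist e x y + gdist e y z)%N.
Proof.
move=> /gdistP[p [ep lp <-]] /gdistP[q [eq lq <-]].
have := @gdist_min _ e x (p ++ q); rewrite cat_path ep lp eq last_cat lp lq size_cat.
exact.
Qed.

Lemma gdist_refl (T : finType) (e : rel T) x : gdist e x x = 0%N.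
Proof. by apply/eqP; rewrite -leqn0; apply: (@gdist_min _ e x [::]). Qed.

Lemma gdist_gt0 (T : finType) (e : rel T) x y :
  connect e x y -> x != y -> (0 < gdist e x y)%N.
Proof. by move=> /gdistP[[|z p] [_ /= <- <-]] //; rewrite eqxx. Qed.

Lemma sqr_triangle x y z : (z <= x + y -> z ^ 2 <= 2 * x ^ 2 + 2 * y ^ 2)%N.
Proof.
rewrite -(leq_exp2r _ _ (isT : 0 < 2)%N) => /leq_trans; apply.
by rewrite sqrnD; have := (nat_Cauchy x y).1; lia.
Qed.

Lemma edge_sum_ordered (R : realType) n (F : 'I_n * 'I_n -> R) (G : edge_set n) :
  simple_graph G -> (forall u v, F (u, v) = F (v, u)) ->
  edge_sum F G = 2 * \sum_(u < n) \sum_(v < n | (u < v)%N && adj G u v) F (u, v).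
Proof.
move=> sG Fsym; rewrite /edge_sum sum_pairs /=.
pose S := \sum_(u < n) \sum_(v < n) (if (u < v)%N && adj G u v then F (u, v) else 0).
have SE : S = \sum_(u < n) \sum_(v < n) (if (v < u)%N && adj G v u then F (v, u)
  else 0).
  exact: exchange_big.
transitivity (S + S).
  rewrite [in X in _ + X]SE /S -big_split /=; apply: eq_bigr => u _.
  rewrite -big_split /=; apply: eq_bigr => v _.
  rewrite (adjC G v u) (Fsym v u); case uv: (adj G u v);
    last by rewrite !andbF mulr0 addr0.
  rewrite !andbT mulr1; have := adj_neq sG uv.
  by rewrite -val_eqE /=; case: (ltngtP u v) => // _; rewrite ?addr0 ?add0r.
rewrite mulr2n mulrDl mul1r; congr (_ + _); apply: eq_bigr => u _;
  exact: esym (big_mkcond _ _).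
Qed.

(** Markov's inequality: each vertex has on average at most d |S| / (n - 1)
    neighbours in S. *)
Lemma weighted_degree_small (R : realType) n d (w : 'I_n -> R) (S : {set 'I_n}) :
  (1 < n)%N -> (0 < d)%N -> (forall u, 0 <= w u) ->
  #|[set G in regular_graphs n d |
      d%:R * (\sum_u w u) / 2 < \sum_u w u * (\sum_(v in S) adj G u v)%:R]|%:R
  <= #|regular_graphs n d|%:R * (4 * #|S|%:R / n%:R) :> R.
Proof.
move=> n1 d0 w0; set W := \sum_u w u; set N := #|regular_graphs n d|%:R;
  set B := [set G in _ | _].
pose Y (G : edge_set n) : R := \sum_u w u * (\sum_(v in S) adj G u v)%:R.
have W0 : 0 <= W by exact: sumr_ge0.
have n1R : 2 <= n%:R :> R by rewrite (ler_nat R 2).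
have d0R : 0 < d%:R :> R by rewrite ltr0n.
have N0 : 0 <= N :> R by rewrite ler0n.
have pr0 : 0 <= edge_probability R n d by rewrite divr_ge0 //; lra.
have Y0 G : 0 <= Y G by apply: sumr_ge0 => u _; rewrite mulr_ge0.
have mean : \sum_(G in regular_graphs n d) Y G <=
  W * (#|S|%:R * (edge_probability R n d * N)).
  rewrite exchange_big mulr_suml /=; apply: ler_sum => u _.
  rewrite -mulr_sumr ler_wpM2l //.
  under eq_bigr => G _ do rewrite natr_sum.
  rewrite exchange_big /= mulr_natl -sumr_const; apply: ler_sum => v _.
  rewrite sumr_indicator -/(card_edge d u v).
  have [->|uv] := eqVneq u v; last by rewrite card_edge_probability.
  rewrite (_ : card_edge d v v = 0%N) ?mulr0n ?(mulr_ge0 pr0 N0) //.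
  apply/eqP; rewrite /card_edge cards_eq0; apply/eqP/setP => G; rewrite !inE.
  by apply/negP => /andP[/andP[sG _] /(adj_neq sG)]; rewrite eqxx.
have lower : #|B|%:R * (d%:R * W / 2) <= \sum_(G in regular_graphs n d) Y G.
  apply: (@le_trans _ _ (\sum_(G in B) Y G)); last first.
    rewrite [leRHS](big_setID B) /= -[leLHS]addr0 lerD //; last exact: sumr_ge0.
    by rewrite (_ : _ :&: B = B) //; apply/setIidPr/subsetP => G;
      rewrite inE => /andP[].
  rewrite mulr_natl -sumr_const; apply: ler_sum => G; rewrite inE => /andP[_].
  exact: ltW.
have [Wz|Wp] := eqVneq W 0.
  rewrite (_ : B = finset.set0) ?cards0;
    first by rewrite mulr_ge0 // divr_ge0 // mulr_ge0.
  apply/setP => G; rewrite !inE Wz mulr0 mul0r big1 ?ltxx ?andbF // => u _.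
  move/eqP: Wz; rewrite psumr_eq0 // => /allP/(_ u);
    rewrite mem_index_enum => /(_ isT)/eqP ->.
  by rewrite mul0r.
have Wgt : 0 < W by rewrite lt_def Wp.
have dW : 0 < d%:R * W / 2 by rewrite !mulr_gt0 //; lra.
rewrite -(ler_pM2r dW); apply: le_trans lower (le_trans mean _).
have -> : N * (4 * #|S|%:R / n%:R) * (d%:R * W / 2) =
  W * (#|S|%:R * (2 * d%:R / n%:R * N)).
  by field; lra.
rewrite ler_wpM2l // ler_wpM2l // ler_wpM2r // /edge_probability.
rewrite ler_pdivrMr; last lra.
rewrite mulrAC ler_pdivlMr; last lra.
nra.
Qed.

(** If some fibre of f contains nearly all vertices, then the edges between that
    fibre and the other vertices carry enough weight; otherwise so many pairs
    have positive distance that the sum over the edges is concentrated. *)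
Lemma card_not_gamma_le (R : realType) n m d (H : edge_set m) (f : 'I_n -> 'I_m) :
  connected_graph H -> (5 < n)%N -> (0 < d)%N ->
  #|[set G in regular_graphs n d | ~~ gamma_le d G H f (16 : R)]|%:R
  <= #|regular_graphs n d|%:R * (4 / m%:R + (40 / n%:R + 8 * m%:R ^+ 3 / (d%:R *
    n%:R))) :> R.
Proof.
move=> cH n5 d0.
have n5R : 6 <= n%:R :> R by rewrite (ler_nat R 6).
have d0R : 0 < d%:R :> R by rewrite ltr0n.
have m0 : (0 < m)%N by case: m f H cH => // f;
  case: (f (Ordinal (ltnW (ltnW (ltnW (ltnW (ltnW n5))))))).
have m0R : 0 < m%:R :> R by rewrite ltr0n.
have conn x y : connect (adj H) x y by move/forallP: cH => /(_ x)/forallP.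
have symH : symmetric (adj H) by move=> x y; exact: adjC.
pose g x y := gdist (adj H) x y.
pose F (p : 'I_n * 'I_n) : R := (g (f p.1) (f p.2) ^ 2)%:R.
have FC u v : F (u, v) = F (v, u) by rewrite /F /= /g gdistC.
have F0 u : F (u, u) = 0 by rewrite /F /g gdist_refl.
have FM p : 0 <= F p <= m%:R ^+ 2.
  rewrite ler0n /= -natrX ler_nat leq_exp2r // -[m in leqRHS]card_ord ltnW //;
    exact: gdist_lt.
have F1 u v : f u != f v -> 1 <= F (u, v).
  by move=> uv; rewrite /F (ler_nat R 1) expn_gt0 gdist_gt0.
set T := \sum_p F p.
have T0 : 0 <= T by apply: sumr_ge0 => p _; case/andP: (FM p).
have fail (G : edge_set n) : G \in regular_graphs n d -> ~~ gamma_le d G H f (16 : R) ->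
    edge_sum F G < d%:R * T / (8 * n%:R).
  rewrite inE => /andP[sG _]; rewrite /gamma_le -ltNge edge_sum_ordered //.
  set X := \sum_(u < n) \sum_(v < n | _) F (u, v) => bad.
  have {bad} : 16 / (d * n)%:R * X < (n ^ 2)%:R^-1 * T by rewrite /T sum_pairs.
  rewrite natrM natrX ltr_pdivlMr; last lra.
  rewrite -(@ltr_pM2r _ (d%:R * n%:R / 16 * 8 * 2 * n%:R)); last first.
    by rewrite !mulr_gt0 //; lra.
  set a := (X in X < _ -> _); set b := (X in _ < X -> _).
  have -> : a = 2 * X * (8 * n%:R) by rewrite /a; field; lra.
  have -> : b = d%:R * T by rewrite /b; field; lra.
  by [].
have tail0 : 0 <= 40 / n%:R + 8 * m%:R ^+ 3 / (d%:R * n%:R) :> R.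
  by rewrite addr_ge0 // divr_ge0 // ?mulr_ge0 ?exprn_ge0 // ltW.
have N0 : 0 <= #|regular_graphs n d|%:R :> R by rewrite ler0n.
have [/existsP[i small]|/existsPn large] :=
    boolP [exists i, (#|[set u | f u != i]| * m < n)%N].
  (* A fibre with fewer than n / m vertices outside: an edge from u in S to this
     fibre has weight w u, and there are d minus the degree of u into S. *)
  set S := [set u | f u != i] in small.
  pose w u : R := (g (f u) i ^ 2)%:R.
  have w0 u : 0 <= w u by rewrite ler0n.
  set W := \sum_u w u.
  have TW : T <= 4 * n%:R * W.
    rewrite /T sum_pairs.
    apply: (@le_trans _ _ (\sum_u \sum_v (2 * w u + 2 * w v))).
      apply: ler_sum => u _; apply: ler_sum => v _;
        rewrite /F /w /= -!natrM -natrD ler_nat.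
      have := gdist_triangle (conn (f u) i) (conn i (f v)).
      rewrite -!/(g _ _) (_ : g i (f v) = g (f v) i); last by rewrite /g gdistC.
      exact: sqr_triangle.
    under eq_bigr => u _ do
      rewrite big_split /= sumr_const card_ord -mulr_sumr -/W -[X in X + _]mulr_natl.
    rewrite big_split /= sumr_const card_ord -[X in _ + X]mulr_natl -mulr_sumr
      -mulr_sumr -/W.
    by rewrite le_eqVlt; apply/orP; left; apply/eqP; ring.
  apply: (@le_trans _ _ (#|regular_graphs n d|%:R * (4 * #|S|%:R / n%:R))).
    apply: le_trans (@weighted_degree_small R n d w S _ d0 w0); last by lia.
    rewrite ler_nat; apply/subset_leq_card/subsetP => G; rewrite inE => /andP[rG bad].
    rewrite inE rG /= -/W.
    have := fail G rG bad.
    set Y := \sum_u _ => X_lt.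
    have : d%:R * W - Y <= edge_sum F G.
      rewrite /Y /W mulr_sumr -sumrB /edge_sum sum_pairs.
      apply: ler_sum => u _; rewrite mulrC -mulrBr.
      rewrite -{1}(card_adj_regular u rG) (bigID (mem S)) /= natrD addrC addKr.
      rewrite natr_sum mulr_sumr [leRHS](bigID (mem S)) /= -[leLHS]add0r lerD //.
        by apply: sumr_ge0 => v _; rewrite mulr_ge0 //; case/andP: (FM (u, v)).
      apply: ler_sum => v; rewrite inE negbK => /eqP fv.
      by rewrite /w /F /= fv.
    move: X_lt; rewrite ltr_pdivlMr; last lra.
    move: (edge_sum F G) => X h1 h2.
    have : X * (8 * n%:R) < d%:R * (4 * n%:R * W).
      by apply: lt_le_trans h1 _; rewrite ler_wpM2l // ltW.
    rewrite (_ : d%:R * (4 * n%:R * W) = d%:R * W / 2 * (8 * n%:R)); last by field.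
    rewrite ltr_pM2r; last lra.
    lra.
  rewrite ler_wpM2l // -[leLHS]addr0 lerD //.
  rewrite ler_pdivlMr // mulrAC ler_pdivrMr; last lra.
  by rewrite -mulrA ler_wpM2l // -natrM ler_nat ltnW.
(* Every vertex is mapped differently from at least n / m others, and distinct
   vertices of H have distance at least 1. *)
have TN : n%:R ^+ 2 / m%:R <= T.
  rewrite /T sum_pairs.
  rewrite expr2 -mulrA mulr_natl -{2}(card_ord n) -sumr_const; apply: ler_sum => u _.
  rewrite ler_pdivrMr //.
  have := large (f u); rewrite -leqNgt -(ler_nat R) natrM => /le_trans; apply.
  rewrite ler_wpM2r // -[leLHS]sumr_const.
  rewrite [leLHS]big_mkcond; apply: ler_sum => v _; rewrite inE.
  case: ifP => [|_]; last by case/andP: (FM (u, v)).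
  by rewrite eq_sym; exact: F1.
have Tgt : 0 < T by apply: lt_le_trans TN; rewrite divr_gt0 // exprn_gt0; lra.
apply: (@le_trans _ _ (#|[set G in regular_graphs n d | edge_sum F G < d%:R * T /
  (2 * n%:R)]|%:R)).
  rewrite ler_nat; apply/subset_leq_card/subsetP => G; rewrite inE => /andP[rG bad].
  rewrite inE rG /=; apply: lt_le_trans (fail G rG bad) _.
  rewrite ler_wpM2l ?(mulr_ge0 (ltW d0R) T0) // lef_pV2 ?posrE; lra.
apply: le_trans (edge_sum_concentrated n5 d0 F0 FM Tgt) _; rewrite -/T.
rewrite ler_wpM2l // -[leLHS]add0r lerD ?divr_ge0 // ?lerD2l.
rewrite ler_pdivrMr ?mulr_gt0 //.
rewrite [leRHS](_ : _ = 8 * m%:R ^+ 2 * n%:R * (T / (n%:R ^+ 2 / m%:R)));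
  last by field; lra.
rewrite -[leLHS]mulr1 ler_wpM2l ?mulr_ge0 //.
by rewrite ler_pdivlMr ?mul1r // divr_gt0 // exprn_gt0; lra.
Qed.

(** * Both graphs random *)

(** The bound of [card_not_gamma_le] is the same for all connected H, so it can
    be summed over H; what remains is the proportion of disconnected H. *)
Lemma uniform_pr_connected_gamma_le (R : realType) d : (3 <= d)%N ->
  exists K : R, forall n m (f : 'I_n -> 'I_m),
    (4 * (blocked_pairs d).+2 <= m)%N -> (m ^ 4 <= n)%N ->
    ~~ odd (n * d) -> ~~ odd (m * d) ->
    1 - K / Num.sqrt m%:R <=
      uniform_pr R (finset.setX (regular_graphs n d) (regular_graphs m d))
        (fun GH => connected_graph GH.2 && gamma_le d GH.1 GH.2 f (16 : R)) <= 1.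
Proof.
move=> d3; have [K disc] := card_disconnected_small R d3.
exists (K + 52) => n m f mc mn evn evm.
have m8 : (8 <= m)%N by apply: leq_trans mc; lia.
have mlen : (m <= n)%N by apply: leq_trans mn;
  rewrite -[leqLHS]expn1 leq_pexp2l //; lia.
have Gn : (0 < #|regular_graphs n d|)%N by apply: regular_graphs_gt0 => //; lia.
have Gm : (0 < #|regular_graphs m d|)%N by apply: regular_graphs_gt0 => //; lia.
rewrite /uniform_pr cardsX natrM.
set N := #|regular_graphs n d|%:R; set M := #|regular_graphs m d|%:R.
have N0 : 0 < N :> R by rewrite ltr0n.
have M0 : 0 < M :> R by rewrite ltr0n.
have NM0 : 0 < N * M by rewrite mulr_gt0.
pose good (GH : edge_set n * edge_set m) :=
  connected_graph GH.2 && gamma_le d GH.1 GH.2 f (16 : R).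
pose X := finset.setX (regular_graphs n d) (regular_graphs m d).
pose A := [set GH in X | good GH].
rewrite -[X in X%:R / _]/(#|A|).
pose B := [set GH in X | ~~ good GH].
have AB : (#|A| + #|B|)%N = #|X|.
  rewrite -(cardsID [set GH | good GH] X); congr (_ + _)%N; apply: eq_card => GH;
    rewrite !inE //.
  by rewrite andbC.
have ABR : #|A|%:R = N * M - #|B|%:R :> R.
  by rewrite /N /M -natrM -cardsX -/X -AB natrD addrK.
rewrite ler_pdivrMr // ler_pdivlMr // mul1r; apply/andP; split;
  last by rewrite ABR lerBlDr lerDl.
rewrite ABR mulrBl mul1r lerD2l lerN2.
have m0 : 0 < m%:R :> R by rewrite ltr0n; lia.
have n0 : 0 < n%:R :> R by rewrite ltr0n; lia.
have s0 : 0 < Num.sqrt m%:R :> R by rewrite sqrtr_gt0.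
set s := Num.sqrt _ in s0 *.
have s2 : s ^+ 2 = m%:R by rewrite sqr_sqrtr // ltW.
have tail : 4 / m%:R + (40 / n%:R + 8 * m%:R ^+ 3 / (d%:R * n%:R)) <= 52 / s :> R.
  have m1 : 1 <= m%:R :> R by rewrite (ler_nat R 1); lia.
  have s1 : 1 <= s by rewrite -[1]sqrtr1 ler_wsqrtr.
  have d1 : 1 <= d%:R :> R by rewrite (ler_nat R 1); lia.
  have mnR : m%:R ^+ 4 <= n%:R :> R by rewrite -natrX ler_nat.
  have sm : s <= m%:R by rewrite -s2 expr2 ler_peMl // ltW.
  have h1 : 4 / m%:R <= 4 / s by rewrite ler_wpM2l // lef_pV2 ?posrE.
  have h2 : 40 / n%:R <= 40 / s.
    by rewrite ler_wpM2l // lef_pV2 ?posrE // (le_trans sm) // ler_nat.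
  have h3 : 8 * m%:R ^+ 3 / (d%:R * n%:R) <= 8 / s.
    rewrite -[leLHS]mulrA ler_wpM2l // ler_pdivrMr ?mulr_gt0 //; last by lra.
    rewrite mulrC ler_pdivlMr //.
    apply: (@le_trans _ _ (m%:R ^+ 3 * m%:R));
      first by rewrite ler_wpM2l // exprn_ge0 // ltW.
    rewrite -exprSr; apply: le_trans mnR _.
    by rewrite ler_peMl // ltW.
  have -> : 52 / s = 4 / s + (40 / s + 8 / s) by field; rewrite gt_eqF.
  by rewrite !lerD.
pose D := [set H in regular_graphs m d | ~~ connected_graph H].
pose E H := [set G in regular_graphs n d | ~~ gamma_le d G H f (16 : R)].
have n5 : (5 < n)%N by apply: leq_trans mlen; apply: leq_trans m8.
have d0 : (0 < d)%N by apply: leq_trans d3.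
have EH H : connected_graph H -> #|E H|%:R <= N * (52 / s) :> R.
  move=> cH; apply: (le_trans (@card_not_gamma_le R n m d H f cH n5 d0)).
  by rewrite ler_wpM2l // ltW.
have cB : #|B|%:R <= \sum_(H in regular_graphs m d) (N * ((~~ connected_graph H)%:R
  + 52 / s)) :> R.
  rewrite card_sections_snd natr_sum [leRHS]big_mkcond /=; apply: ler_sum => H _.
  case: ifP => HM; last first.
    rewrite (_ : [set a | (a, H) \in B] = finset.set0) ?cards0 //.
    by apply/setP => G; rewrite in_set0 2!inE /X in_setX /= HM andbF.
  have [cH|dH] := boolP (connected_graph H); rewrite /=.
    rewrite add0r; apply: (le_trans _ (EH H cH)); rewrite ler_nat;
      apply/subset_leq_card/subsetP => G.
    by rewrite 2!inE /X in_setX /good /= cH HM andbT [in X in _ -> X]in_set.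
  apply: (@le_trans _ _ N).
    rewrite ler_nat; apply/subset_leq_card/subsetP => G.
    by rewrite 2!inE /X in_setX /= => /andP[/andP[-> _] _].
  by rewrite -[leLHS]mulr1 ler_wpM2l ?lerDl ?divr_ge0 // ltW.
apply: le_trans cB _.
rewrite -mulr_sumr big_split /= sumr_const -[X in _ + X]mulr_natr -/M
  sumr_indicator -/D.
have := disc m mc; rewrite -/s -/D -/M -ler_pdivlMr // => discM.
rewrite (_ : (K + 52) / s * (N * M) = N * (K * M / s + 52 / s * M)); last first.
  by field; rewrite gt_eqF.
by rewrite ler_wpM2l ?lerD2r // ltW.
Qed.

Local Open Scope classical_set_scope.
Local Open Scope ring_scope.

(** Turns the growth condition into the bound m^3 / n <= 1 / m on the failure
    probability coming from G. *)
Lemma leq_pow4_of_growth (R : realType) (eps : R) (n m : nat) :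
  eps <= 1 -> (0 < n)%N -> expR 1 <= m%:R :> R ->
  m%:R ^+ 2 * ln m%:R <= n%:R `^ (eps / 2) -> (m ^ 4 <= n)%N.
Proof.
move=> eps1 n0 em le.
have m0 : 0 < m%:R :> R by apply: lt_le_trans em; exact: expR_gt0.
have ln1 : 1 <= ln m%:R :> R by rewrite -[leLHS]expRK ler_ln ?posrE ?expR_gt0 //.
have n1 : 1 <= n%:R :> R by rewrite (ler_nat R 1).
have : m%:R ^+ 2 <= Num.sqrt n%:R :> R.
  rewrite -powR12_sqrt ?ler0n //; apply: (@le_trans _ _ (n%:R `^ (eps / 2))).
    by apply: le_trans le; rewrite ler_peMr // exprn_ge0 // ltW.
  by rewrite ler_powR // ler_pdivrMr // mulVf.
move=> h; rewrite -(ler_nat R) natrX -[leRHS]sqr_sqrtr ?ler0n // (exprM _ 2 2).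
by rewrite ler_pXn2r ?nnegrE ?sqrtr_ge0 ?exprn_ge0 ?ler0n.
Qed.

Theorem theorem4 (R : realType) (eps : R) (d : nat) (m : nat -> nat)
    (f : forall n : nat, 'I_n -> 'I_(m n)) :
  0 < eps < 1 ->
  (3 <= d)%N ->
  (forall n : nat, ~~ odd (n * d) -> ~~ odd (m n * d)) ->
  m n @[n --> even_oo d] --> \oo ->
  (fun n : nat => (m n)%:R ^+ 2 * ln (m n)%:R : R^o)
    =o_ (even_oo d) (fun n : nat => n%:R `^ (eps / 2) : R^o) ->
  exists C : R,
    uniform_pr R
      (finset.setX (regular_graphs n d) (regular_graphs (m n) d))
      (fun GH => connected_graph GH.2 && gamma_le d GH.1 GH.2 (f n) C)
    @[n --> even_oo d] --> (1 : R).
Proof.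
move=> /andP[eps0 eps1] d3 evm m_oo m_small.
have [K pr] := uniform_pr_connected_gamma_le R d3.
exists 16; apply/cvgrPdist_le => e e0.
have m_ge (k : nat) : \forall n \near even_oo d, (k <= m n)%N.
  exact: (m_oo _ (nbhs_infty_ge k)).
have even_n : \forall n \near even_oo d, ~~ odd (n * d).
  by rewrite /even_oo near_withinE; apply: nearW.
have n_gt0 : \forall n \near even_oo d, (0 < n)%N.
  by apply: cvg_within; exact: nbhs_infty_gt.
have small : \forall n \near even_oo d,
    (m n)%:R ^+ 2 * ln (m n)%:R <= n%:R `^ (eps / 2) :> R.
  move/eqoP: m_small => /(_ 1 ltr01); apply: filterS => n.
  rewrite mul1r /= => h; apply: le_trans (ler_norm _) (le_trans h _).
  by rewrite ger0_norm // powR_ge0.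
near=> n.
have mc : (4 * (blocked_pairs d).+2 <= m n)%N by near: n; exact: m_ge.
have em : expR 1 <= (m n)%:R :> R.
  apply: (@le_trans _ _ (Num.truncn (expR 1 : R)).+1%:R); first exact/ltW/truncnS_gt.
  by rewrite ler_nat; near: n; exact: m_ge.
have Ke : (K / e) ^+ 2 <= (m n)%:R.
  apply: (@le_trans _ _ (Num.truncn ((K / e) ^+ 2)).+1%:R); first exact/ltW/truncnS_gt.
  by rewrite ler_nat; near: n; exact: m_ge.
have evn : ~~ odd (n * d) by near: n.
have n0 : (0 < n)%N by near: n.
have m4 : (m n ^ 4 <= n)%N.
  by apply: (leq_pow4_of_growth (ltW eps1) n0 em); near: n.
have /andP[lo hi] := pr n (m n) (f n) mc m4 evn (evm n evn).
rewrite ger0_norm ?subr_ge0 // lerBlDr -lerBlDl; apply: le_trans lo.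
rewrite lerB // ler_pdivrMr; last by rewrite sqrtr_gt0 ltr0n; apply: leq_trans mc.
rewrite mulrC -ler_pdivrMr //; apply: ler_of_sqr; first exact: sqrtr_ge0.
by rewrite sqr_sqrtr.
Unshelve. all: by end_near.
Qed.
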